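(* In the model described in the context, assume that the Bayes predictor $f^*$ satisfies: there exists $M>0$ such that for all $(v,s)\in[0,1]\times[K]$ the law $\mu_{f^*\mid v,s}$ is non-atomic and supported in $[-M,M]$. Then the solution $f_0^*$ of $$\min_{f\in\mathcal F}\{\mathcal R(f): f\text{ is counterfactually fair}\}$$ admits the closed form $$f_0^*(\mathbf x,s)=\Big(\sum_{s'=1}^K w_{s'}F^{-1}_{f^*\mid v,s'}\Big)\circ F_{f^*\mid v,s}\big(f^*(\mathbf x,s)\big),\qquad v=\psi(\mathbf x,s),$$ and its risk satisfies $\mathcal R(f_0^* )\le\mathcal U(f^* )$.
   Context: Model: $(\mathbf X,V,S,Y)$ takes values in $\mathcal X\times[0,1]\times[K]\times\mathbb R$, with $\mathcal X\subseteq\mathbb R^d$ measurable and $[K]=\{1,\dots,K\}$; $w_s=\mathbb P(S=s)>0$; $V\sim\nu=\mathrm{Unif}[0,1]$ is independent of $S$; there is a measurable $\psi$ with $V=\psi(\mathbf X,S)$ a.s. $\mathcal F$ is the set of measurable predictors $f:\mathcal X\times[K]\to\mathbb R$. $f^*(\mathbf X,S)=\mathbb E[Y\mid\mathbf X,S]$. For $f\in\mathcal F$, $\mu_{f\mid v,s}$ is the conditional law of $f(\mathbf X,S)$ given $V=v,S=s$, with c.d.f. $F_{f\mid v,s}$ and quantile function $F^{-1}_{f\mid v,s}(u)=\inf\{t:F_{f\mid v,s}(t)\ge u\}$. Risk: $\mathcal R_v(f)=\sum_s w_s\mathbb E[(f(\mathbf X,S)-f^*(\mathbf X,S))^2\mid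 V=v,S=s]$ and $\mathcal R(f)=\int_0^1\mathcal R_v(f)\,d\nu(v)$. Unfairness: $\mathcal U_v(f)=\min_{\mu\in\mathcal P_2(\mathbb R)}\sum_s w_s\mathcal W_2^2(\mu_{f\mid v,s},\mu)$ and $\mathcal U(f)=\int_0^1\mathcal U_v(f)\,d\nu(v)$, where $\mathcal P_2(\mathbb R)$ is the set of probability measures on $\mathbb R$ with finite second moment and $\mathcal W_2$ is the Wasserstein-2 distance. $f$ is counterfactually fair iff for $\nu$-almost every $v$ the laws $\mu_{f\mid v,s}$, $s\in[K]$, all coincide (equivalently, $\mathcal U(f)=0$). *)

(* Defs.v *)
From HB Require Import structures.
From mathcomp Require Import all_boot all_order all_algebra.
From mathcomp Require Import all_classical all_reals all_analysis.

Set Implicit Arguments.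
Unset Strict Implicit.
Unset Printing Implicit Defensive.
Import Order.TTheory GRing.Theory Num.Theory.
Import numFieldNormedType.Exports.

Local Open Scope classical_set_scope.
Local Open Scope ring_scope.

(* [K] is 'I_K with its discrete sigma-algebra, R^d is d.-tuple R, and a
   function on XX * [K], with XX a measurable subset of R^d, is a function on
   R^d and 'I_K whose values outside of XX are never used. *)

Definition unif01 (R : realType) : probability (measurableTypeR R) R :=
  uniform_prob (@ltr01 R).

Definition weight d0 (Omega : measurableType d0) (R : realType) (K : nat)
    (P : probability Omega R) (S : Omega -> 'I_K) (s : 'I_K) : R :=
  fine (P (S @^-1` [set s])).

Definition indep_of_index d0 (Omega : measurableType d0) (R : realType)
    (K : nat) (P : probability Omega R) (V : Omega -> R) (S : Omega -> 'I_K) :=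
  forall (A : set R) (B : set 'I_K), measurable A ->
    P (V @^-1` A `&` S @^-1` B) = (P (V @^-1` A) * P (S @^-1` B))%E.

Definition predictor (R : realType) (d K : nat) (XX : set (d.-tuple R))
    (f : d.-tuple R -> 'I_K -> R) :=
  forall s, measurable_fun XX (f ^~ s).

(* fstar (X, S) is a version of E[Y | X, S]; the events of sigma(X, S) are the
   sets {X \in C_S} for a family C of measurable sets. *)
Definition bayes_predictor d0 (Omega : measurableType d0) (R : realType)
    (d K : nat) (P : probability Omega R) (XX : set (d.-tuple R))
    (X : Omega -> d.-tuple R) (S : Omega -> 'I_K) (Y : Omega -> R)
    (fstar : d.-tuple R -> 'I_K -> R) :=
  [/\ predictor XX fstar,
      P.-integrable [set: Omega] (fun o => (Y o)%:E),
      P.-integrable [set: Omega] (fun o => (fstar (X o) (S o))%:E) &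
      forall C : 'I_K -> set (d.-tuple R), (forall s, measurable (C s)) ->
        (\int[P]_(o in [set o | C (S o) (X o)]) (fstar (X o) (S o))%:E =
         \int[P]_(o in [set o | C (S o) (X o)]) (Y o)%:E)%E].

(* kappa s v is a version, supported by XX, of the law of X given V = v and
   S = s.  All the conditional laws and expectations given V = v and S = s
   below are derived from this regular version. *)
Definition cond_law d0 (Omega : measurableType d0) (R : realType)
    (d K : nat) (P : probability Omega R) (XX : set (d.-tuple R))
    (X : Omega -> d.-tuple R) (V : Omega -> R) (S : Omega -> 'I_K)
    (kappa : 'I_K -> R.-pker R ~> d.-tuple R) :=
  (forall s v, v \in `[0, 1] -> kappa s v (~` XX) = 0%E) /\
  (forall (A : 'I_K -> set R) (B : set (d.-tuple R)),
     (forall s, measurable (A s)) -> measurable B ->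
     (P ([set o | A (S o) (V o)] `&` X @^-1` B) =
      \int[P]_(o in [set o | A (S o) (V o)]) kappa (S o) (V o) B)%E).

(* mu_{f | v, s} *)
Definition pred_law (R : realType) (d K : nat) (XX : set (d.-tuple R))
    (kappa : 'I_K -> R.-pker R ~> d.-tuple R) (f : d.-tuple R -> 'I_K -> R)
    (v : R) (s : 'I_K) : set R -> \bar R :=
  fun B => kappa s v (XX `&` (f ^~ s) @^-1` B).

Definition cdf_of (R : realType) (mu : set R -> \bar R) (t : R) : R :=
  fine (mu `]-oo, t]%classic).

Definition quantile (R : realType) (mu : set R -> \bar R) (u : R) : R :=
  inf [set t | u <= cdf_of mu t].

Definition nonatomic (R : realType) (mu : set R -> \bar R) :=
  forall t, mu [set t] = 0%E.

Definition supported_in (R : realType) (mu : set R -> \bar R) (A : set R) :=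
  mu (~` A) = 0%E.

Definition P2 (R : realType) : set (probability R R) :=
  [set mu : probability R R | (\int[mu]_x (x ^+ 2)%:E < +oo)%E].

Definition couplings (R : realType) (mu nu : set R -> \bar R) :
    set (probability (R * R)%type R) :=
  [set pi : probability (R * R)%type R | forall B : set R, measurable B ->
    pi (B `*` setT) = mu B /\ pi (setT `*` B) = nu B].

Definition W2 (R : realType) (mu nu : set R -> \bar R) : \bar R :=
  sqrte (ereal_inf
    [set (\int[pi]_z ((z.1 - z.2) ^+ 2)%:E)%E | pi in couplings mu nu]).

Definition risk_at (R : realType) (d K : nat) (w : 'I_K -> R)
    (XX : set (d.-tuple R)) (kappa : 'I_K -> R.-pker R ~> d.-tuple R)
    (fstar f : d.-tuple R -> 'I_K -> R) (v : R) : \bar R :=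
  (\sum_(s < K) (w s)%:E *
     \int[kappa s v]_(x in XX) ((f x s - fstar x s) ^+ 2)%:E)%E.

Definition risk (R : realType) (d K : nat) (w : 'I_K -> R)
    (XX : set (d.-tuple R)) (kappa : 'I_K -> R.-pker R ~> d.-tuple R)
    (fstar f : d.-tuple R -> 'I_K -> R) : \bar R :=
  (\int[unif01 R]_(v in `[0%R, 1%R]) risk_at w XX kappa fstar f v)%E.

Definition unfairness_at (R : realType) (d K : nat) (w : 'I_K -> R)
    (XX : set (d.-tuple R)) (kappa : 'I_K -> R.-pker R ~> d.-tuple R)
    (f : d.-tuple R -> 'I_K -> R) (v : R) : \bar R :=
  ereal_inf [set (\sum_(s < K)
    (w s)%:E * W2 (pred_law XX kappa f v s) mu ^+ 2)%E | mu in @P2 R].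

Definition unfairness (R : realType) (d K : nat) (w : 'I_K -> R)
    (XX : set (d.-tuple R)) (kappa : 'I_K -> R.-pker R ~> d.-tuple R)
    (f : d.-tuple R -> 'I_K -> R) : \bar R :=
  (\int[unif01 R]_(v in `[0%R, 1%R]) unfairness_at w XX kappa f v)%E.

Definition counterfactually_fair (R : realType) (d K : nat)
    (XX : set (d.-tuple R)) (kappa : 'I_K -> R.-pker R ~> d.-tuple R)
    (f : d.-tuple R -> 'I_K -> R) :=
  {ae unif01 R, forall v, forall (s s' : 'I_K) (B : set R), measurable B ->
    pred_law XX kappa f v s B = pred_law XX kappa f v s' B}.

Definition fair_solution (R : realType) (d K : nat) (w : 'I_K -> R)
    (XX : set (d.-tuple R)) (kappa : 'I_K -> R.-pker R ~> d.-tuple R)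
    (fstar f : d.-tuple R -> 'I_K -> R) :=
  [/\ predictor XX f, counterfactually_fair XX kappa f &
      forall g : d.-tuple R -> 'I_K -> R,
        predictor XX g -> counterfactually_fair XX kappa g ->
        (risk w XX kappa fstar f <= risk w XX kappa fstar g)%E].

(* The quantile function is only meaningful at levels u > 0; the level
   F_{fstar | v, s} (fstar (x, s)) vanishes only on a null event. *)
Definition f0star (R : realType) (d K : nat) (w : 'I_K -> R)
    (XX : set (d.-tuple R)) (kappa : 'I_K -> R.-pker R ~> d.-tuple R)
    (psi fstar : d.-tuple R -> 'I_K -> R) : d.-tuple R -> 'I_K -> R :=
  fun x s =>
    let v := psi x s in
    \sum_(s' < K) w s' *
      quantile (pred_law XX kappa fstar v s')
        (cdf_of (pred_law XX kappa fstar v s) (fstar x s)).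

(* Main.v *)
Require Import Defs.
From HB Require Import structures.
From mathcomp Require Import all_boot all_order all_algebra.
From mathcomp Require Import all_classical all_reals all_analysis.
From mathcomp Require Import measurable_realfun ring lra.

Set Implicit Arguments.
Unset Strict Implicit.
Unset Printing Implicit Defensive.
Import Order.TTheory GRing.Theory Num.Theory.
Import numFieldNormedType.Exports.

Local Open Scope classical_set_scope.
Local Open Scope ring_scope.

(* Fix v and write mu_s for the law of f^* given V = v and S = s.  Layer by
   layer, (x - y)^2 = 2 \int_b gap(x, b, [y <= b]) db where
   gap(x, b, h) = (x - b)^+ if h and (b - x)^+ otherwise.  For every level b
   choose c_s such that \sum_s w_s c_s = b and mu_s(]-oo, c_s]) does not depend
   on s.  Then
     gap(x, b, h) = gap(x, b, [x <= c_s]) + (c_s - b) (h - [x <= c_s])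
                    + |x - c_s| [h <> [x <= c_s]],
   and when h = [y <= b] for a second coordinate y whose law does not depend on
   s, the middle term vanishes after averaging over s.  So at each level
   h = [x <= c_s] is optimal, and it is essentially the only optimal choice
   because mu_s is non-atomic; the barycentric map f0 realises it at all levels
   simultaneously.  The bound holds for arbitrary couplings of the mu_s with a
   common second marginal, which gives at once the optimality of f0 among fair
   predictors, its uniqueness, and the comparison with the unfairness. *)

(** * Levels of weighted averages of quantile functions *)

(** The thresholds come from the averaged quantile function Q = \sum_s w_s Q_s. With the
    distribution functions F_s sloped into surjections of R, p(b) is the largest level u such that
    Q(u) <= b, and the c_s are points of the level sets of the F_s at p(b), chosen so that their
    average is exactly b. Hence f0 <= b reads Q(F_s(x)) <= b, that is F_s(x) <= F_s(c_s), and this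
    is x <= c_s except on a plateau of F_s, which is null. This is why one closed form serves all
    levels. Arguing by layers avoids the theory of optimal transport: neither an optimal coupling
    nor a barycentre has to exist beforehand. Three difficulties remain. The cost of a competitor
    may be infinite, so only finite terms may be subtracted. Quantiles make sense only at positive
    levels, so the event where F_s vanishes must be shown null. Finally f0 is written with [psi x s]
    instead of v, so [kappa s v] has to be shown to live on psi = v for almost every v. *)

Lemma continuous_bounds (R : realType) (F : R -> R) (x e : R) :
  continuous F -> 0 < e ->
  exists2 d, 0 < d & F (x + d) <= F x + e /\ F x - e <= F (x - d).
Proof.
move=> cF e0; have /cvgrPdist_le /(_ e e0) := cF x.
move=> /nbhs_ballP [d /= d0 hd]; exists (d / 2); first by lra.
split.
  have /= := hd (x + d / 2); rewrite /ball/= => /(_ _)/wrap[].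
    by rewrite opprD addNKr normrN ger0_norm; lra.
  by rewrite ler_norml => /andP[h1 _]; lra.
have /= := hd (x - d / 2); rewrite /ball/= => /(_ _)/wrap[].
  by rewrite opprB addrC subrK ger0_norm; lra.
by rewrite ler_norml => /andP[h1 h2]; lra.
Qed.

Section level.
Context (R : realType) (K : nat) (F : 'I_K -> R -> R).
Hypothesis cF : forall s, continuous (F s).
Hypothesis ndF : forall s x y, x <= y -> F s x <= F s y.
Hypothesis FNy : forall s u, exists t, F s t <= u.
Hypothesis Fy : forall s u, exists t, u <= F s t.

(** Left continuity at the infimum gives F(l) <= p, right continuity gives p <= F(l); [Fy] and [FNy]
    make the set nonempty and bounded below. *)
Lemma level_inf p s : let l := inf [set t | p <= F s t] in
  F s l = p /\ forall t, p <= F s t -> l <= t.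
Proof.
set A : set R := [set t | p <= F s t] => l.
have A0 : A !=set0 by have [t] := Fy s p; exists t.
have [t0 t0p] := FNy s (p - 1).
have lA : has_lbound A.
  exists t0 => t /= pt; rewrite leNgt; apply/negP => /ltW/(ndF s) tt0.
  by have := le_trans pt (le_trans tt0 t0p); lra.
have hA : has_inf A by split.
split; last by move=> t; exact: ge_inf.
apply/eqP; rewrite eq_le; apply/andP; split; apply/ler_addgt0Pr => e e0.
  have [d d0 [_ h]] := continuous_bounds l (@cF s) e0.
  have : F s (l - d) < p.
    by rewrite ltNge; apply/negP => hl; have := ge_inf lA hl; rewrite -/l; lra.
  by lra.
have [d d0 [h _]] := continuous_bounds l (@cF s) e0.
have [t /= pt tl] := inf_adherent d0 hA.
by have := ndF s (ltW tl); have : p <= F s t := pt; rewrite -/l; lra.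
Qed.

Lemma level_lower p s :
  exists2 l, F s l = p & forall e, 0 < e -> F s (l - e) < p.
Proof.
have [Fl hl] := level_inf p s; exists (inf [set t | p <= F s t]) => // e e0.
by rewrite ltNge; apply/negP => /hl; lra.
Qed.

End level.

Section weighted_level.
Context (R : realType) (K : nat) (w : 'I_K -> R) (F : 'I_K -> R -> R).
Hypotheses (w_ge0 : forall s, 0 <= w s) (w1 : \sum_s w s = 1).
Hypothesis cF : forall s, continuous (F s).
Hypothesis ndF : forall s x y, x <= y -> F s x <= F s y.
Hypothesis FNy : forall s u, exists t, F s t <= u.
Hypothesis Fy : forall s u, exists t, u <= F s t.

(** This is [level_lower] for the reflected function x -> - F(- x), which exchanges the two ends of
    a level set. *)
Lemma level_upper p s :
  exists2 h, F s h = p & forall e, 0 < e -> p < F s (h + e).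
Proof.
have := @level_lower R K (fun s x => - F s (- x)) _ _ _ _ (- p) s.
case=> //.
- move=> i x; apply: (@cvgN _ R^o).
  by apply: (@continuous_comp _ _ _ -%R (F i)); [exact: opp_continuous|exact: cF].
- by move=> i x y xy; rewrite lerN2; apply: ndF; rewrite lerN2.
- by move=> i u; have [t ut] := Fy i (- u); exists (- t); rewrite opprK lerNl.
- by move=> i u; have [t ut] := FNy i (- u); exists (- t); rewrite opprK lerNr.
move=> l /oppr_inj Fl h; exists (- l) => // e /h.
by rewrite opprB ltrN2 addrC.
Qed.

(* For F the distribution functions of the laws of f^* and positive levels u,
   reachable b u says that the averaged quantile function is at most b at u. *)
Definition reachable (b u : R) :=
  exists2 c : 'I_K -> R, \sum_s w s * c s <= b & forall s, u <= F s (c s).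

(** There is an index because the weights sum to 1. Taking the worst index turns strict inequalities
    at each s into one with a common margin. *)
Lemma exists_max_index (f : 'I_K -> R) : exists i, forall j, f j <= f i.
Proof.
have K0 : (0 < K)%N.
  rewrite lt0n; apply/eqP => K0; move: w1; rewrite big1 => [/eqP|[i iK] _].
    by rewrite eq_sym oner_eq0.
  by exfalso; move: iK; rewrite K0.
by case: (@arg_maxP _ _ _ (Ordinal K0) xpredT f isT) => i _ h; exists i => j; exact: h.
Qed.

Lemma weighted_shift (c : 'I_K -> R) e :
  \sum_s w s * (c s + e) = \sum_s w s * c s + e.
Proof.
under eq_bigr do rewrite mulrDr.
by rewrite big_split/= -mulr_suml w1 mul1r.
Qed.

Lemma weighted_le (c c' : 'I_K -> R) : (forall s, c s <= c' s) ->
  \sum_s w s * c s <= \sum_s w s * c' s.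
Proof. by move=> h; apply: ler_sum => s _; exact: ler_wpM2l. Qed.

(** Take for p the supremum of the reachable levels. The level set of F_s at p is an interval with
    ends [lo s] and [hi s]; b lies between the averages of the lower and of the upper ends, so one
    interpolation parameter, common to all s, gives points of average b. *)
Lemma weighted_level b : exists p (c : 'I_K -> R),
  [/\ \sum_s w s * c s = b, forall s, F s (c s) = p &
      forall u, reachable b u <-> u <= p].
Proof.
pose A : set R := [set u | reachable b u].
have sumb : \sum_s w s * b = b by rewrite -mulr_suml w1 mul1r.
have A0 : A !=set0.
  have [i hi] := exists_max_index (fun s => - F s b).
  exists (F i b); exists (fun=> b); first by rewrite sumb.
  by move=> s; have := hi s; lra.
have bA : has_ubound A.
  have [i hi] := exists_max_index (fun s => F s b).
  exists (F i b) => u [c cb uc]; rewrite leNgt; apply/negP => Fu.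
  have bc s : b < c s.
    rewrite ltNge; apply/negP => /(ndF s) h.
    by have := uc s; have := hi s; lra.
  have [k hk] := exists_max_index (fun s => - c s).
  have : \sum_s w s * c k <= \sum_s w s * c s.
    by apply: weighted_le => s; have := hk s; lra.
  by rewrite -mulr_suml w1 mul1r; have := bc k; lra.
have hA : has_sup A by split.
set p := sup A.
have [lo loP] : exists lo : 'I_K -> R, forall s,
    F s (lo s) = p /\ forall e, 0 < e -> F s (lo s - e) < p.
  have H s : exists l, F s l = p /\ forall e, 0 < e -> F s (l - e) < p.
    by have [l] := level_lower cF ndF FNy Fy p s; exists l.
  by have [lo] := choice H; exists lo.
have [hi hiP] : exists hi : 'I_K -> R, forall s,
    F s (hi s) = p /\ forall e, 0 < e -> p < F s (hi s + e).
  have H s : exists l, F s l = p /\ forall e, 0 < e -> p < F s (l + e).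
    by have [l] := level_upper p s; exists l.
  by have [h] := choice H; exists h.
(* All F_s(lo_s - e) stay below p by a common margin, so some reachable level exceeds them all, and
   its points lie to the right of every lo_s - e. *)
have lob : \sum_s w s * lo s <= b.
  apply/ler_addgt0Pr => e e0.
  have [i him] := exists_max_index (fun s => F s (lo s - e)).
  have pi : 0 < p - F i (lo i - e) by have := (loP i).2 e e0; lra.
  have [u [c cb uc]] := sup_adherent pi hA; rewrite -/p => pu.
  have : \sum_s w s * (lo s - e) <= \sum_s w s * c s.
    apply: weighted_le => s; rewrite leNgt; apply/negP => /ltW/(ndF s) h.
    by have := uc s; have := him s; lra.
  by rewrite !weighted_shift; lra.
(* Otherwise the points hi_s + e would have average below b for some e, and would make reachable the
   least F_s(hi_s + e), which exceeds p. *)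
have hib : b <= \sum_s w s * hi s.
  apply/ler_addgt0Pr => e e0; rewrite -weighted_shift leNgt; apply/negP => h.
  have [i him] := exists_max_index (fun s => - F s (hi s + e)).
  have : A (F i (hi i + e)).
    by exists (fun s => hi s + e); [exact: ltW|move=> s; have := him s; lra].
  move=> /(sup_upper_bound hA); rewrite -/p.
  by have := (hiP i).2 e e0; lra.
pose a := \sum_s w s * lo s; pose a' := \sum_s w s * hi s.
have lohi s : lo s <= hi s.
  rewrite leNgt; apply/negP => h.
  by have := (hiP s).2 (lo s - hi s) ltac:(lra); rewrite addrC subrK (loP s).1 ltxx.
have [th [th0 th1 thb]] : exists th : R, [/\ 0 <= th, th <= 1 & a + th * (a' - a) = b].
  have [aa|aa] := eqVneq a a'.
    by exists 0; split => //; move: lob hib; rewrite -/a -/a'; lra.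
  have aa0 : 0 < a' - a by move: lob hib aa; rewrite -/a -/a' neq_lt => ? ? /orP[]; lra.
  exists ((b - a) / (a' - a)); split.
  - by rewrite divr_ge0//; move: lob; rewrite -/a; lra.
  - by rewrite ler_pdivrMr// mul1r; move: hib; rewrite -/a'; lra.
  - by rewrite divfK ?gt_eqF//; lra.
exists p, (fun s => lo s + th * (hi s - lo s)).
have Fc s : F s (lo s + th * (hi s - lo s)) = p.
  have h : 0 <= hi s - lo s by have := lohi s; lra.
  have h0 : 0 <= th * (hi s - lo s) by rewrite mulr_ge0.
  have h1 : th * (hi s - lo s) <= hi s - lo s by rewrite ler_piMl.
  apply/eqP; rewrite eq_le -{1}(hiP s).1 -(loP s).1.
  by apply/andP; split; apply: ndF; lra.
have sb : \sum_s w s * (lo s + th * (hi s - lo s)) = b.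
  rewrite -thb /a /a' -sumrB mulr_sumr -big_split/=.
  by apply: eq_bigr => s _; ring.
split => // u; split => [/(sup_upper_bound hA)//|up].
by exists (fun s => lo s + th * (hi s - lo s)); [rewrite sb|move=> s; rewrite Fc].
Qed.

End weighted_level.

(** * Distribution functions of non-atomic laws *)

Lemma negligible_bigcup_count d (T : measurableType d) (R : realType)
    (mu : {measure set T -> \bar R}) (I : countType) (N : I -> set T) :
  (forall i, mu.-negligible (N i)) -> mu.-negligible (\bigcup_i N i).
Proof.
move=> hN; pose N' n := oapp N set0 (unpickle n).
apply: (@negligibleS _ _ _ _ (\bigcup_n N' n)).
  by move=> x [i _ Nix]; exists (pickle i); rewrite // /N' pickleK.
apply: negligible_bigcup => n; rewrite /N'.
by case: (unpickle n) => [i|] /=; [exact: hN|exact: negligible_set0].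
Qed.

Section nonatomic_cdf.
Context (R : realType) (mu : probability R R).
Implicit Types s t : R.

Lemma cdf_ofE t : (cdf_of mu t)%:E = mu `]-oo, t]%classic.
Proof. by rewrite /cdf_of fineK// fin_num_measure. Qed.

Lemma cdf_of_nd s t : s <= t -> cdf_of mu s <= cdf_of mu t.
Proof.
move=> st; rewrite -lee_fin !cdf_ofE le_measure ?inE//.
exact: subset_itvl.
Qed.

Lemma cdf_of_le1 t : cdf_of mu t <= 1.
Proof. by rewrite -lee_fin cdf_ofE probability_le1. Qed.

Lemma cdf_of_ge0 t : 0 <= cdf_of mu t.
Proof. by rewrite -lee_fin cdf_ofE. Qed.

Lemma measure_itvoc s t : s <= t ->
  mu `]s, t]%classic = (cdf_of mu t - cdf_of mu s)%:E.
Proof.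
move=> st; rewrite EFinB !cdf_ofE.
have -> : `]s, t]%classic = `]-oo, t]%classic `\` `]-oo, s]%classic.
  by rewrite -[RHS]setCK setCD setCitvl setUC -[LHS]setCK setCitv.
rewrite measureD// ?setIidr//; first exact: subset_itvl.
by rewrite ltey_eq fin_num_measure.
Qed.

Lemma cdf_of_right t e : 0 < e -> 
  exists2 d, 0 < d & cdf_of mu (t + d) <= cdf_of mu t + e.
Proof.
move=> e0.
have cv : mu `]-oo, (t + n.+1%:R^-1)]%classic @[n --> \oo] --> mu `]-oo, t]%classic.
  rewrite (@itvNycEbigcap _ false); apply: nonincreasing_cvg_mu => //.
  - by rewrite ltey_eq fin_num_measure.
  - by apply: bigcap_measurable.
  - move=> m n mn; apply/subsetPset; apply: subset_itvl.
    by rewrite bnd_simp lerD2l lef_pV2 ?posrE// ler_nat.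
have /cvgrPdist_le /(_ e e0) : cdf_of mu (t + n.+1%:R^-1) @[n --> \oo] --> cdf_of mu t.
  by apply: fine_cvg; rewrite fineK// fin_num_measure.
move=> [n _ /(_ n (leqnn n))] /=; rewrite ler_norml => /andP[h _].
by exists n.+1%:R^-1; [rewrite invr_gt0|lra].
Qed.

Hypothesis mu_na : nonatomic mu.

(** The intervals ]t - 1/(n+1), t] shrink to the point t, whose mass is 0. *)
Lemma cdf_of_left t e : 0 < e -> 
  exists2 d, 0 < d & cdf_of mu t - e <= cdf_of mu (t - d).
Proof.
move=> e0.
have cap : \bigcap_n `](t - n.+1%:R^-1), t]%classic = [set t].
  apply/seteqP; split => [x h|_ -> n _]; last first.
    by rewrite /= in_itv/= lexx andbT gtrBl invr_gt0.
  have := h 0%N I; rewrite /= in_itv/= => /andP[_ xt].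
  apply/eqP; rewrite eq_le xt/= leNgt; apply/negP => tx.
  have tx0 : 0 < t - x by lra.
  have := h (Num.truncn (t - x)^-1) I; rewrite /= in_itv/= => /andP[+ _].
  apply/negP; rewrite -leNgt.
  by rewrite lerBrDr -lerBrDl invf_ple ?posrE//; exact/ltW/truncnS_gt.
have cv : mu `](t - n.+1%:R^-1), t]%classic @[n --> \oo] --> 0%E.
  rewrite -(mu_na t) -cap; apply: nonincreasing_cvg_mu => //.
  - by rewrite ltey_eq fin_num_measure.
  - by apply: bigcap_measurable.
  - move=> m n mn; apply/subsetPset; apply: subset_itvr.
    by rewrite bnd_simp lerD2l lerN2 lef_pV2 ?posrE// ler_nat.
have /cvgrPdist_le /(_ e e0) : fine (mu `](t - n.+1%:R^-1), t]%classic) @[n --> \oo] --> 0.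
  exact: fine_cvg.
move=> [n _ /(_ n (leqnn n))] /=.
rewrite measure_itvoc ?gerBl ?invr_ge0//= ler_norml => /andP[h _].
by exists n.+1%:R^-1; [rewrite invr_gt0|lra].
Qed.

Lemma cdf_of_continuous : continuous (cdf_of mu).
Proof.
move=> t; apply/cvgrPdist_le => e e0.
have [d d0 h] := cdf_of_left t e0.
have [d' d'0 h'] := cdf_of_right t e0.
apply/nbhs_ballP; exists (Num.min d d') => /=; first by rewrite lt_min d0.
move=> x; rewrite /ball/= lt_min ltr_norml => /andP[/andP[_ h1]].
rewrite ltr_norml => /andP[h2 _].
have h3 : cdf_of mu (t - d) <= cdf_of mu x by apply: cdf_of_nd; lra.
have h4 : cdf_of mu x <= cdf_of mu (t + d') by apply: cdf_of_nd; lra.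
by rewrite ler_norml; apply/andP; split; lra.
Qed.

(* A level set of the distribution function is an interval whose rational
   right end points all cut out null sets. *)
Lemma cdf_level_null c : mu.-negligible [set t | c < t /\ cdf_of mu t <= cdf_of mu c].
Proof.
set E := [set _ | _].
(* A greatest element of the level set has no rational of the set to its right; there is at most one
   such point, and it is not an atom. *)
pose m := [set t | E t /\ forall t', E t' -> t' <= t].
have subE : E `<=` m `|` \bigcup_(q : rat)
    (if `[< E (ratr q) >] then `]c, (ratr q : R)]%classic else set0).
  move=> t Et; have [h|] := pselect (forall t', E t' -> t' <= t); first by left.
  move=> /existsNP[t' /not_implyP[Et' /negP]]; rewrite -ltNge => /rat_in_itvoo[q].
  rewrite in_itv/= => /andP[tq qt']; right; exists q => //.
  case: Et Et' => ct Ft [ct' Ft'].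
  have -> : `[< E (ratr q) >].
    apply/asboolP; split; first exact: lt_trans tq.
    by apply: le_trans Ft'; apply: cdf_of_nd; exact: ltW.
  by rewrite /= in_itv/= ct ltW.
have m0 : mu.-negligible m.
  have [[t [Et ht]]|nm] := pselect (exists t, m t).
    apply: (@negligibleS _ _ _ _ [set t]); last by apply/negligibleP => //; exact: mu_na.
    by move=> u [Eu hu]; apply/eqP; rewrite eq_le ht ?hu.
  apply: (@negligibleS _ _ _ _ set0); last exact: negligible_set0.
  by move=> u mu'; apply: nm; exists u.
apply: negligibleS subE _; apply: negligibleU => //.
apply: negligible_bigcup_count => q.
case: ifPn => [/asboolP[cq Fq]|_]; last exact: negligible_set0.
apply/negligibleP => //; apply: (etrans (measure_itvoc (ltW cq))); congr EFin.
by have := cdf_of_nd (ltW cq); lra.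
Qed.

End nonatomic_cdf.

(** * Layers of the quadratic cost *)

(** On each measurable E in D, both the integral over E and the one over D minus E can only grow
    from f to g; as the totals are finite and equal, the integrals over E agree. No difference g - f
    is formed, since g may take infinite values. *)
Lemma le_integral_ae_eq d (T : measurableType d) (R : realType)
    (mu : {measure set T -> \bar R}) (D : set T) (f g : T -> \bar R) :
  measurable D -> measurable_fun D f -> measurable_fun D g ->
  (forall x, D x -> 0 <= f x)%E -> (forall x, D x -> 0 <= g x)%E ->
  {ae mu, forall x, D x -> (f x <= g x)%E} ->
  (\int[mu]_(x in D) g x <= \int[mu]_(x in D) f x)%E ->
  (\int[mu]_(x in D) f x < +oo)%E ->
  ae_eq mu D f g.
Proof.
move=> mD mf mg f0 g0 fg gf foo.
have intf : mu.-integrable D f.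
  apply/integrableP; split => //; rewrite (eq_integral f)// => x /[!inE] Dx.
  by rewrite gee0_abs ?f0.
apply: integral_ae_eq => // E ED mE.
have mDE : measurable (D `\` E) by exact: measurableD.
have DE : D = E `|` (D `\` E) by rewrite setDUK.
have disj : [disjoint E & D `\` E] by apply/disj_setPS => x [? []].
have mono A : A `<=` D -> measurable A ->
    (\int[mu]_(x in A) f x <= \int[mu]_(x in A) g x)%E.
  move=> AD mA; apply: ae_ge0_le_integral => //.
  - by move=> x /AD; exact: f0.
  - exact: measurable_funS mf.
  - by move=> x /AD; exact: g0.
  - exact: measurable_funS mg.
  - by apply: filterS fg => x h /AD.
apply/eqP; rewrite eq_le mono//=.
have splitE (h : T -> \bar R) : measurable_fun D h -> (forall x, D x -> 0 <= h x)%E ->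
    (\int[mu]_(x in D) h x =
     \int[mu]_(x in E) h x + \int[mu]_(x in D `\` E) h x)%E.
  move=> mh h0; rewrite {1}DE ge0_integral_setU//; first by rewrite -DE.
  by rewrite -DE.
rewrite (splitE f)// (splitE g)// in gf foo.
have DED : D `\` E `<=` D by move=> x [].
have h1 := mono E ED mE; have h2 := mono _ DED mDE.
move: gf foo h1 h2.
have [a0 b0] : (0 <= \int[mu]_(x in E) f x /\ 0 <= \int[mu]_(x in D `\` E) f x)%E.
  by split; apply: integral_ge0 => x; [move/ED|move/DED]; exact: f0.
move: a0 b0; case: (\int[mu]_(x in E) f x)%E => [a||] //;
  case: (\int[mu]_(x in D `\` E) f x)%E => [b||] //;
  case: (\int[mu]_(x in E) g x)%E => [a'||] //;
  case: (\int[mu]_(x in D `\` E) g x)%E => [b'||] //=.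
by rewrite -!EFinD !lee_fin; lra.
Qed.

(** With k = x and the sign e = 1 or -1, the integrand is the gap as a function of the level, on the
    interval between x and y where it can be nonzero. *)
Lemma integral_affine (R : realType) (a b k e : R) : a <= b ->
  (\int[lebesgue_measure]_(t in `[a, b[) (e * (t - k))%:E =
   (e * ((b - k) ^+ 2 - (a - k) ^+ 2) / 2)%:E)%E.
Proof.
rewrite le_eqVlt => /predU1P[->|ab].
  by rewrite set_itvco0 integral_set0 subrr mulr0 mul0r.
have dF t : is_derive t (1 : R) (fun t : R => e * (t - k) ^+ 2 / 2) (e * (t - k)).
  by apply: is_derive_eq; rewrite /GRing.scale/=; field.
have cF : continuous (fun t : R => e * (t - k) ^+ 2 / 2).
  by move=> t; have [/derivable1_diffP/differentiable_continuous] := dF t.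
have cf : continuous (fun t : R => e * (t - k)).
  move=> t; apply: cvgM; first exact: cvg_cst.
  by apply: cvgB; [exact: cvg_id|exact: cvg_cst].
rewrite integral_itv_bndo_bndc; last first.
  by apply/measurable_EFinP; apply: measurable_funTS; exact: continuous_measurable_fun.
rewrite (@continuous_FTC2 _ _ (fun t : R => e * (t - k) ^+ 2 / 2))//.
- by rewrite -EFinB; congr EFin; field.
- exact: continuous_subspaceT.
- split.
  + by move=> t _; have [] := dF t.
  + by apply: cvg_at_right_filter; exact: cF.
  + by apply: cvg_at_left_filter; exact: cF.
- by move=> t _; rewrite derive1E; have [] := dF t.
Qed.

Section gap.
Context {R : realType}.
Implicit Types (x y b c : R) (h : bool).

(* Up to the factor 2, the layer of level b of (x - y) ^ 2 when h = (y <= b). *)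
Definition gap x b h : R := if h then Num.max (x - b) 0 else Num.max (b - x) 0.

Lemma gap_ge0 x b h : 0 <= gap x b h.
Proof. by rewrite /gap; case: h; rewrite le_max lexx orbT. Qed.

Lemma integral_gap x y :
  (\int[lebesgue_measure]_b (gap x b (y <= b))%:E = ((x - y) ^+ 2 / 2)%:E)%E.
Proof.
have [xy|yx] := leP x y.
  transitivity (\int[lebesgue_measure]_(t in `[x, y[) (1 * (t - x))%:E)%E.
    rewrite [RHS]integral_mkcond; apply: eq_integral => b _.
    rewrite patchE mem_setE in_itv/= /gap.
    case: (leP y b) => yb; rewrite ?andbT ?andbF.
      by rewrite max_r//; lra.
    case: (leP x b) => xb /=; last by rewrite max_r//; lra.
    by rewrite max_l ?mul1r//; lra.
  by rewrite integral_affine//; congr EFin; field.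
transitivity (\int[lebesgue_measure]_(t in `[y, x[) (- 1 * (t - x))%:E)%E.
  rewrite [RHS]integral_mkcond; apply: eq_integral => b _.
  rewrite patchE mem_setE in_itv/= /gap.
  case: (leP y b) => yb.
    case: (ltP b x) => xb /=; last by rewrite max_r//; lra.
    by rewrite max_l; [congr EFin; ring|lra].
  by rewrite max_r//; lra.
by rewrite integral_affine ?ltW//; congr EFin; field.
Qed.

(** The identity of the overview with c - b split into positive and negative parts, placed so that
    every summand is nonnegative and can be integrated in the extended reals. *)
Lemma gap_excess x b c h :
  gap x b h + (Num.max (c - b) 0 * (x <= c)%R%:R + Num.max (b - c) 0 * h%:R) =
  gap x b (x <= c) +
    (Num.max (c - b) 0 * h%:R + Num.max (b - c) 0 * (x <= c)%R%:R) +
    `|x - c| * (h != (x <= c)%R)%:R.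
Proof.
rewrite /gap !maxEle.
case: h; case: (lerP x c) => xc; rewrite ?mulr1 ?mulr0 ?ger0_norm ?ler0_norm; try lra;
  case: (lerP (x - b) 0) => ?; case: (lerP (b - x) 0) => ?; case: (lerP (c - b) 0) => ?;
  case: (lerP (b - c) 0) => ?; lra.
Qed.

Lemma gap_le x b c : gap x b (x <= c) <= `|b - c|.
Proof.
rewrite /gap; case: ifPn; rewrite -?ltNge => xc; rewrite ge_max normr_ge0 andbT;
  have := ler_norm (b - c); have := ler_norm (c - b); rewrite (distrC c b); lra.
Qed.

Lemma measurable_gap d (T : measurableType d) (f g : T -> R) (h : T -> bool) :
  measurable_fun setT f -> measurable_fun setT g -> measurable_fun setT h ->
  measurable_fun setT (fun t => gap (f t) (g t) (h t)).
Proof.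
move=> mf mg mh; apply: measurable_fun_ifT => //.
  by apply: measurable_maxr => //; exact: measurable_funB.
by apply: measurable_maxr => //; exact: measurable_funB.
Qed.

End gap.

(** * Layers of a coupling and their decomposition *)

Section layer.
Context {R : realType}.
Implicit Types (pi : probability (R * R)%type R) (b c : R).

Definition layer pi b : \bar R := (\int[pi]_z (gap z.1 b (z.2 <= b))%:E)%E.

Definition mass_fst pi c : R := fine (pi [set z | z.1 <= c]).
Definition mass_snd pi b : R := fine (pi [set z | z.2 <= b]).
Definition excess pi b c : \bar R :=
  (\int[pi]_z (`|z.1 - c| * ((z.2 <= b)%R != (z.1 <= c)%R)%:R)%:E)%E.

Lemma measurable_bool_natmul d (T : measurableType d) (h : T -> bool) :
  measurable_fun setT h -> measurable_fun setT (fun t => (h t)%:R : R).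
Proof.
move=> mh; rewrite (_ : (fun _ => _) = (fun t => if h t then 1 else 0)).
  exact: measurable_fun_ifT.
by apply/funext => t; case: (h t).
Qed.

Lemma measurable_fst_le c : measurable_fun setT (fun z : R * R => z.1 <= c).
Proof. by apply: measurable_fun_ler => //; exact: measurable_fst. Qed.

Lemma measurable_snd_le c : measurable_fun setT (fun z : R * R => z.2 <= c).
Proof. by apply: measurable_fun_ler => //; exact: measurable_snd. Qed.

Lemma measurable_xor b c :
  measurable_fun setT (fun z : R * R => (z.2 <= b)%R != (z.1 <= c)%R).
Proof.
rewrite (_ : (fun _ => _) = (fun z : R * R => if z.2 <= b then ~~ (z.1 <= c) else z.1 <= c)).
  apply: measurable_fun_ifT; [exact: measurable_snd_le| |exact: measurable_fst_le].
  by apply: measurable_neg; exact: measurable_fst_le.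
by apply/funext => z; case: (_ <= _); case: (_ <= _).
Qed.

Lemma sqr_cost_layer pi :
  (\int[pi]_z ((z.1 - z.2) ^+ 2)%:E =
   2%:E * \int[lebesgue_measure]_b layer pi b)%E.
Proof.
pose f (zb : (R * R) * R) : \bar R := (gap zb.1.1 zb.2 (zb.1.2 <= zb.2))%:E.
have m11 : measurable_fun setT (fun zb : (R * R) * R => zb.1.1).
  by apply: (measurableT_comp measurable_fst); exact: measurable_fst.
have m12 : measurable_fun setT (fun zb : (R * R) * R => zb.1.2).
  by apply: (measurableT_comp measurable_snd); exact: measurable_fst.
have m2 : measurable_fun setT (fun zb : (R * R) * R => zb.2) by exact: measurable_snd.
have mf : measurable_fun setT f.
  apply/measurable_EFinP; apply: measurable_gap => //.
  exact: measurable_fun_ler.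
have f0 z : (0 <= f z)%E by rewrite lee_fin gap_ge0.
have := @fubini_tonelli _ _ _ _ _ pi lebesgue_measure f mf f0.
rewrite /layer /f /= => <-.
rewrite -ge0_integralZl//; last first.
- by move=> z _; apply: integral_ge0 => b _; rewrite lee_fin gap_ge0.
- exact: (@measurable_fun_fubini_tonelli_F _ _ _ _ _ lebesgue_measure f mf f0).
apply: eq_integral => z _; rewrite integral_gap -EFinM; congr EFin.
by rewrite mulrC divfK.
Qed.

Lemma measurable_layer pi : measurable_fun setT (layer pi).
Proof.
pose f (zb : (R * R) * R) : \bar R := (gap zb.1.1 zb.2 (zb.1.2 <= zb.2))%:E.
apply: (@measurable_fun_fubini_tonelli_G _ _ _ _ _ pi f); last by move=> z; rewrite lee_fin gap_ge0.
have m11 : measurable_fun setT (fun zb : (R * R) * R => zb.1.1).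
  by apply: (measurableT_comp measurable_fst); exact: measurable_fst.
have m12 : measurable_fun setT (fun zb : (R * R) * R => zb.1.2).
  by apply: (measurableT_comp measurable_snd); exact: measurable_fst.
have m2 : measurable_fun setT (fun zb : (R * R) * R => zb.2) by exact: measurable_snd.
by apply/measurable_EFinP; apply: measurable_gap => //; exact: measurable_fun_ler.
Qed.

Lemma layer_ge0 pi b : (0 <= layer pi b)%E.
Proof. by apply: integral_ge0 => z _; rewrite lee_fin gap_ge0. Qed.

Lemma excess_ge0 pi b c : (0 <= excess pi b c)%E.
Proof. by apply: integral_ge0 => z _; rewrite lee_fin mulr_ge0. Qed.

Lemma integral_scaled_bool pi (k : R) (h : R * R -> bool) :
  measurable_fun setT h -> 0 <= k ->
  (\int[pi]_z (k * (h z)%:R)%:E = (k * fine (pi [set z | h z]))%:E)%E.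
Proof.
move=> mh k0.
have mA : measurable [set z | h z].
  by have := mh measurableT [set true]; rewrite setTI; apply.
under eq_integral do rewrite EFinM.
rewrite ge0_integralZl//=; last first.
  by apply/measurable_EFinP; exact: measurable_bool_natmul.
rewrite EFinM fineK ?fin_num_measure// -[X in pi X]setIT -integral_indic//.
by congr (_ * _)%E; apply: eq_integral => z _; rewrite indicE mem_setE.
Qed.

Lemma measurable_gap_fst (h : R * R -> bool) b : measurable_fun setT h ->
  measurable_fun setT (fun z : R * R => (gap z.1 b (h z))%:E).
Proof.
move=> mh; apply/measurable_EFinP; apply: measurable_gap => //.
Qed.

(** Deciding by a threshold c costs at most |b - c|, so this term may be cancelled even when the
    quadratic cost is infinite. *)
Lemma integral_gap_fst_fin pi b c :
  (\int[pi]_z (gap z.1 b (z.1 <= c))%:E)%E \is a fin_num.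
Proof.
rewrite ge0_fin_numE; last by apply: integral_ge0 => z _; rewrite lee_fin gap_ge0.
apply: (@le_lt_trans _ _ (\int[pi]_z (`|b - c|)%:E)%E).
  apply: ge0_le_integral => //=.
  - by move=> z _; rewrite lee_fin gap_ge0.
  - by apply: measurable_gap_fst; exact: measurable_fst_le.
  - by move=> z _; rewrite lee_fin gap_le.
by rewrite integral_cst//= probability_setT mule1 ltry.
Qed.

Lemma layerE pi b c : layer pi b =
  (\int[pi]_z (gap z.1 b (z.1 <= c))%:E +
   ((c - b) * (mass_snd pi b - mass_fst pi c))%:E + excess pi b c)%E.
Proof.
set al := Num.max (c - b) 0; set be := Num.max (b - c) 0.
have al0 : 0 <= al by rewrite le_max lexx orbT.
have be0 : 0 <= be by rewrite le_max lexx orbT.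
have albe : al - be = c - b.
  by rewrite /al /be !maxEle; case: (lerP (c - b) 0); case: (lerP (b - c) 0); lra.
have mr (h : R * R -> bool) (k : R) : measurable_fun setT h ->
    measurable_fun setT (fun z : R * R => (k * (h z)%:R)%:E).
  by move=> mh; apply/measurable_EFinP/measurable_funM => //; exact: measurable_bool_natmul.
have m1 := measurable_fst_le c; have m2 := measurable_snd_le b.
have key : (layer pi b + (al * mass_fst pi c + be * mass_snd pi b)%:E =
   \int[pi]_z (gap z.1 b (z.1 <= c))%:E +
   (al * mass_snd pi b + be * mass_fst pi c)%:E + excess pi b c)%E.
  rewrite !EFinD /mass_fst /mass_snd -!integral_scaled_bool// /layer /excess.
  have mx : measurable_fun setT (fun z : R * R => (`|z.1 - c| * ((z.2 <= b)%R != (z.1 <= c)%R)%:R)%:E).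
    apply/measurable_EFinP/measurable_funM.
      by apply: measurableT_comp => //; apply: measurable_funB => //; exact: measurable_fst.
    by apply: measurable_bool_natmul; exact: measurable_xor.
  have g1 := measurable_gap_fst b m1; have g2 := measurable_gap_fst b m2.
  rewrite -!ge0_integralD//=; try by [move=> z _; rewrite ?adde_ge0// lee_fin ?gap_ge0 ?mulr_ge0
    |exact: mr|apply: emeasurable_funD; exact: mr|
     apply: emeasurable_funD => //; apply: emeasurable_funD; exact: mr].
  by apply: eq_integral => z _; rewrite -!EFinD; congr EFin; exact: gap_excess.
(* The layer itself may be infinite, but the term added and subtracted is a real number. *)
have -> : layer pi b = (layer pi b + (al * mass_fst pi c + be * mass_snd pi b)%:E -
  (al * mass_fst pi c + be * mass_snd pi b)%:E)%E by rewrite addeK.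
rewrite key [LHS]addeAC; congr (_ + _)%E; rewrite -addeA; congr (_ + _)%E.
by rewrite -EFinB; congr EFin; rewrite -albe; ring.
Qed.

(** The integrand vanishes almost everywhere and its factor |z.1 - t| is zero only at z.1 = t, a
    null event: without atoms, zero excess determines the decision. *)
Lemma excess_eq0 (m : probability (R * R)%type R) b t : (forall x, m [set z | z.1 = x] = 0%E) ->
  excess m b t = 0%E ->
  m.-negligible [set z | (z.2 <= b)%R != (z.1 <= t)%R].
Proof.
move=> na ex0.
have mx : measurable_fun setT (fun z : R * R =>
    (`|z.1 - t| * ((z.2 <= b)%R != (z.1 <= t)%R)%:R)%:E).
  apply/measurable_EFinP/measurable_funM.
    by apply: measurableT_comp => //; apply: measurable_funB => //; exact: measurable_fst.
  by apply: measurable_bool_natmul; exact: measurable_xor.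
have /(ae_eq_integral_abs m measurableT mx) : (\int[m]_(z in setT)
   `|(`|z.1 - t| * ((z.2 <= b)%R != (z.1 <= t)%R)%:R)%:E|)%E = 0%E.
  rewrite -ex0; apply: eq_integral => z _.
  by rewrite gee0_abs// lee_fin mulr_ge0.
move=> h.
have mt : measurable [set z : R * R | z.1 = t].
  by have := @measurable_fst _ _ R R measurableT [set t] (measurable_set1 t); rewrite setTI; apply.
have n0 : m.-negligible [set z | z.1 = t] by apply/negligibleP; [|exact: na].
apply: negligibleS (negligibleU h n0) => z /= hz.
have [zt|zt] := eqVneq z.1 t; [by right|left].
apply/not_implyP; split => //; apply/eqP; rewrite eqe hz mulr1.
by rewrite normr_eq0 subr_eq0.
Qed.

End layer.

(** * Total cost of families of couplings with a common second marginal *)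

Section comparison.
Context {R : realType} {K : nat} (w : 'I_K -> R).
Hypotheses (w_gt0 : forall s, 0 < w s) (w1 : \sum_s w s = 1).
Implicit Types pi : 'I_K -> probability (R * R)%type R.

Definition total_layer pi (b : R) : \bar R :=
  (\sum_(s < K) (w s)%:E * layer (pi s) b)%E.

Definition total_cost pi : \bar R :=
  (\sum_(s < K) (w s)%:E * \int[pi s]_z ((z.1 - z.2) ^+ 2)%:E)%E.

Let wE0 s : (0 <= (w s)%:E)%E. Proof. by rewrite lee_fin ltW. Qed.

Lemma total_layer_ge0 pi b : (0 <= total_layer pi b)%E.
Proof. by apply: sume_ge0 => s _; rewrite mule_ge0 ?layer_ge0. Qed.

Lemma measurable_total_layer pi : measurable_fun setT (total_layer pi).
Proof.
apply: emeasurable_sum => s.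
by apply: measurable_funeM; exact: measurable_layer.
Qed.

Lemma total_costE pi :
  total_cost pi = (2%:E * \int[lebesgue_measure]_b total_layer pi b)%E.
Proof.
rewrite /total_layer ge0_integral_sum//; first last.
- by move=> s b _; rewrite mule_ge0 ?layer_ge0.
- by move=> s; apply: measurable_funeM; exact: measurable_layer.
rewrite ge0_sume_distrr; last first.
  move=> s _; apply: integral_ge0 => b _.
  by rewrite mule_ge0 ?layer_ge0.
apply: eq_bigr => s _; rewrite sqr_cost_layer muleCA; congr (_ * _)%E.
rewrite ge0_integralZl//; first exact: measurable_layer.
by move=> b _; exact: layer_ge0.
Qed.

Section marginals.
(** [pi0] is the candidate optimum, deciding at each level b by the thresholds [c b s], and [pi] is
    a competitor. [snd_eq] will come from the fairness of a predictor, or from a single target law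
    in the definition of the unfairness. *)
Variables pi pi0 : 'I_K -> probability (R * R)%type R.
Hypothesis fst_eq : forall s B, measurable B ->
  pi s (B `*` setT) = pi0 s (B `*` setT).
Hypothesis snd_eq : forall s s' b, mass_snd (pi s) b = mass_snd (pi s') b.
Variable c : R -> 'I_K -> R.
Hypothesis cb : forall b, \sum_s w s * c b s = b.
Hypothesis c_mass : forall b s s',
  mass_fst (pi0 s) (c b s) = mass_fst (pi0 s') (c b s').
Hypothesis c_null : forall b s,
  (pi0 s).-negligible [set z | (z.2 <= b)%R != (z.1 <= c b s)%R].

Lemma fst_slab (A : set R) : [set z : R * R | A z.1] = A `*` setT.
Proof. by apply/seteqP; split => [z ?|z []]. Qed.

Lemma mass_fst_eq s t : mass_fst (pi s) t = mass_fst (pi0 s) t.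
Proof.
rewrite /mass_fst (fst_slab [set x | x <= t]) fst_eq//.
by rewrite -set_itvNyc.
Qed.

Lemma integral_fst_eq s (h : R -> \bar R) :
  measurable_fun setT h -> (forall x, 0 <= h x)%E ->
  (\int[pi s]_z h z.1 = \int[pi0 s]_z h z.1)%E.
Proof.
move=> mh h0.
have H (m : probability (R * R)%type R) : (\int[m]_z h z.1 = \int[pushforward m fst]_x h x)%E.
  by rewrite ge0_integral_pushforward//=; exact: measurable_fst.
rewrite !H; apply: eq_measure_integral => A mA _.
by have := fst_eq s mA; rewrite -(fst_slab A).
Qed.

Lemma excess0 s b : excess (pi0 s) b (c b s) = 0%E.
Proof.
rewrite /excess (@ae_eq_integral _ _ _ (pi0 s) setT (cst 0%E)) ?integral0//.
  apply/measurable_EFinP/measurable_funM.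
    by apply: measurableT_comp => //; apply: measurable_funB => //; exact: measurable_fst.
  by apply: measurable_bool_natmul; exact: measurable_xor.
apply: negligibleS (c_null b s) => z /= /not_implyP[_ h].
by apply: contra_notT h; rewrite negbK => /eqP ->; rewrite eqxx mulr0.
Qed.

Lemma mass_snd_pi0 s b : mass_snd (pi0 s) b = mass_fst (pi0 s) (c b s).
Proof.
have mA : measurable [set z : R * R | z.2 <= b].
  by have := measurable_snd_le b measurableT (Y := [set true]); rewrite setTI; apply.
have mB : measurable [set z : R * R | z.1 <= c b s].
  by have := measurable_fst_le (c b s) measurableT (Y := [set true]); rewrite setTI; apply.
rewrite /mass_snd /mass_fst; congr fine.
have := @ae_eq_integral _ _ _ (pi0 s) setT
  (EFin \o \1_[set z : R * R | z.1 <= c b s]) (EFin \o \1_[set z : R * R | z.2 <= b]).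
rewrite !integral_indic// !setIT; apply => //; try exact/measurable_EFinP/measurable_indic.
apply: negligibleS (c_null b s) => z /= /not_implyP[_ h].
apply: contra_notT h; rewrite negbK => /eqP h.
rewrite /= !indicE.
suff -> : (z \in [set z : R * R | z.2 <= b]) = (z \in [set z : R * R | z.1 <= c b s]) by [].
by apply/idP/idP; rewrite !inE /= h.
Qed.

Lemma total_layer_excess b : total_layer pi b =
  (total_layer pi0 b + \sum_(s < K) (w s)%:E * excess (pi s) b (c b s))%E.
Proof.
have I_eq s : (\int[pi s]_z (gap z.1 b (z.1 <= c b s))%:E =
               \int[pi0 s]_z (gap z.1 b (z.1 <= c b s))%:E)%E.
  apply: (@integral_fst_eq s (fun x => (gap x b (x <= c b s))%:E)).
    apply/measurable_EFinP; apply: measurable_gap => //.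
    exact: measurable_fun_ler.
  by move=> x; rewrite lee_fin gap_ge0.
have h0 s : layer (pi0 s) b = (\int[pi0 s]_z (gap z.1 b (z.1 <= c b s))%:E)%E.
  by rewrite (layerE _ _ (c b s)) excess0 mass_snd_pi0 subrr mulr0 !adde0.
have h s : layer (pi s) b = (layer (pi0 s) b +
    ((c b s - b) * (mass_snd (pi s) b - mass_fst (pi0 s) (c b s)))%:E +
    excess (pi s) b (c b s))%E.
  by rewrite (layerE _ _ (c b s)) I_eq -h0 mass_fst_eq.
have step s : ((w s)%:E * layer (pi s) b = (w s)%:E * layer (pi0 s) b +
   (w s * ((c b s - b) * (mass_snd (pi s) b - mass_fst (pi0 s) (c b s))))%:E +
   (w s)%:E * excess (pi s) b (c b s))%E.
  (* Distributivity in the extended reals: this layer is finite, while the excess may be +oo. *)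
  have fin0 : layer (pi0 s) b \is a fin_num by rewrite h0 integral_gap_fst_fin.
  rewrite h EFinM; move: (layer (pi0 s) b) fin0 => [L| |]// _.
  move: (excess (pi s) b (c b s)) (excess_ge0 (pi s) b (c b s)) => X _.
  by rewrite muleDr ?fin_num_adde_defr// muleDr ?fin_num_adde_defr.
have cancel : \sum_(s < K) w s * ((c b s - b) *
    (mass_snd (pi s) b - mass_fst (pi0 s) (c b s))) = 0.
  have [s0 _|noK] := pickP (fun _ : 'I_K => true); last by rewrite big1// => s; have := noK s.
  set q := mass_snd (pi s0) b; set p := mass_fst (pi0 s0) (c b s0).
  rewrite (eq_bigr (fun s => (w s * c b s - w s * b) * (q - p))); last first.
    by move=> s _; rewrite /q /p (snd_eq s0 s) (c_mass b s0 s); ring.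
  by rewrite -mulr_suml sumrB cb -mulr_suml w1; ring.
by rewrite /total_layer (eq_bigr _ (fun s _ => step s)) !big_split/= sumEFin cancel adde0.
Qed.

Lemma total_layer_le b : (total_layer pi0 b <= total_layer pi b)%E.
Proof.
rewrite total_layer_excess leeDl//.
by apply: sume_ge0 => s _; rewrite mule_ge0 ?excess_ge0.
Qed.

Lemma total_cost_le : (total_cost pi0 <= total_cost pi)%E.
Proof.
rewrite !total_costE lee_pmul2l//; apply: ge0_le_integral => //.
- by move=> b _; exact: total_layer_ge0.
- exact: measurable_total_layer.
- exact: measurable_total_layer.
- by move=> b _; exact: total_layer_le.
Qed.

Lemma total_layer_pi0_fin b : total_layer pi0 b \is a fin_num.
Proof.
rewrite /total_layer; apply/sum_fin_numP => s _ _.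
rewrite fin_numM// (layerE _ _ (c b s)) excess0 mass_snd_pi0 subrr mulr0 !adde0.
exact: integral_gap_fst_fin.
Qed.

(** The layers are ordered at every b, so equal finite integrals make them equal for almost every b.
    The layer of [pi0] is finite and cancels, leaving a zero sum of nonnegative excesses with
    positive weights. *)
Lemma total_cost_eq : (total_cost pi <= total_cost pi0)%E ->
  (total_cost pi0 < +oo)%E ->
  {ae lebesgue_measure, forall b, forall s, excess (pi s) b (c b s) = 0%E}.
Proof.
rewrite !total_costE => le_cost fin_cost.
have le_int : (\int[lebesgue_measure]_b total_layer pi b <=
               \int[lebesgue_measure]_b total_layer pi0 b)%E.
  by rewrite lee_pmul2l in le_cost.
have fin_int : (\int[lebesgue_measure]_b total_layer pi0 b < +oo)%E.
  rewrite ltey; apply/eqP => h; move: fin_cost.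
  by rewrite h gt0_muley ?ltxx.
have : ae_eq lebesgue_measure setT (total_layer pi0) (total_layer pi).
  apply: le_integral_ae_eq => //; try exact: measurable_total_layer;
    try by move=> b _; exact: total_layer_ge0.
  by apply: aeW => b _; exact: total_layer_le.
apply: filterS => b /(_ I) h s.
move: h; rewrite total_layer_excess => h.
have h' : (\sum_(s < K) (w s)%:E * excess (pi s) b (c b s) = 0)%E.
  move: h; have := total_layer_pi0_fin b.
  case: (total_layer pi0 b) => // r _; case: (\sum_(s < K) _)%E => // r'.
  by rewrite -EFinD => -[h]; congr EFin; lra.
have nn i : true -> (0 <= (w i)%:E * excess (pi i) b (c b i))%E.
  by move=> _; rewrite mule_ge0 ?excess_ge0.
move/eqP: h'; rewrite seq_psume_eq0//.
move=> /allP /(_ s); rewrite mem_index_enum => /(_ isT) /=.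
by rewrite mule_eq0 eqe gt_eqF//= => /eqP.
Qed.

End marginals.
End comparison.

(** * Conditional laws at a fixed value of V *)

Lemma cdf_of_inj (R : realType) (mu nu : probability R R) :
  (forall t, cdf_of mu t = cdf_of nu t) ->
  forall A, measurable A -> mu A = nu A.
Proof.
move=> h A mA.
apply: (@measure_unique _ _ _ (@ocitv R) (fun n => `]- n%:R, n%:R]%classic)) => //.
- exact: ocitvI.
- by move=> n; exact: is_ocitv.
- exact: bigcup_itvT.
- move=> _ [[a b] _ <-] /=; have [ab|ba] := leP a b.
    by rewrite !measure_itvoc// !h.
  by rewrite set_itv_ge ?measure0// bnd_simp -leNgt ltW.
- by move=> n; rewrite ltey_eq fin_num_measure.
Qed.

Section as_probability.
Context d (T : measurableType d) (R : realType) (m : {measure set T -> \bar R}).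

(** The name carries a probability structure for a measure of total mass 1, such as a value of a
    kernel, so that its images are available as [distribution]. *)
Definition as_probability of m setT = 1%E : set T -> \bar R := fun A => m A.

Hypothesis m1 : m setT = 1%E.

Let as_probability0 : as_probability m1 set0 = 0%E.
Proof. exact: measure0. Qed.

Let as_probability_ge0 A : (0 <= as_probability m1 A)%E.
Proof. exact: measure_ge0. Qed.

Let as_probability_sigma_additive : semi_sigma_additive (as_probability m1).
Proof. exact: measure_semi_sigma_additive. Qed.

HB.instance Definition _ := isMeasure.Build _ _ _ (as_probability m1)
  as_probability0 as_probability_ge0 as_probability_sigma_additive.

HB.instance Definition _ := Measure_isProbability.Build _ _ _ (as_probability m1) m1.

End as_probability.

Lemma law_exists d d' (T : measurableType d) (U : measurableType d')
    (R : realType) (m : {measure set T -> \bar R}) (f : T -> U) :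
  m setT = 1%E -> measurable_fun setT f ->
  exists pi : probability U R,
    (forall B, pi B = m (f @^-1` B)) /\
    (forall h, measurable_fun setT h -> (forall u, 0 <= h u)%E ->
       (\int[pi]_u h u = \int[m]_x h (f x))%E).
Proof.
move=> m1 mf.
pose X : {mfun T >-> U} := HB.pack f (isMeasurableFun.Build _ _ _ _ _ mf).
exists (distribution (as_probability m1) X); split => // h mh h0.
by rewrite ge0_integral_distribution//; exact: eq_measure_integral.
Qed.

Section conditional_laws.
Context (R : realType) (d K : nat) (XX : set (d.-tuple R)).
Context (kappa : 'I_K -> R.-pker R ~> d.-tuple R).
Context (fstar : d.-tuple R -> 'I_K -> R) (v : R).
Hypotheses (mXX : measurable XX) (mfstar : predictor XX fstar).
Hypothesis kXX : forall s, kappa s v (~` XX) = 0%E.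

Lemma kappa_XX s B : measurable B -> kappa s v (XX `&` B) = kappa s v B.
Proof.
move=> mB; have mC : measurable (~` XX) by exact: measurableC.
have mXB : measurable (XX `&` B) by exact: measurableI.
apply/eqP; rewrite eq_le; apply/andP; split.
  by apply: le_measure; rewrite ?inE//; exact: subIsetr.
apply: (@le_trans _ _ (kappa s v (XX `&` B) + kappa s v (~` XX))%E); last first.
  by rewrite kXX adde0.
rewrite -measureU//; last by apply/seteqP; split => // x [[]].
apply: le_measure; rewrite ?inE//; first exact: measurableU.
by move=> x Bx; have [?|?] := pselect (XX x); [left|right].
Qed.

(** Predictors become couplings here: the law of the pair (fstar, f) under [kappa s v] has the
    conditional risk as its quadratic cost. Both functions are extended by 0 outside [XX], where the
    kernel has no mass. *)
Lemma joint_law f s : predictor XX f -> exists pi : probability (R * R)%type R,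
  [/\ forall A, measurable A ->
        pi A = kappa s v (XX `&` [set x | A (fstar x s, f x s)]),
      forall B, measurable B -> pi (B `*` setT) = pred_law XX kappa fstar v s B,
      forall B, measurable B -> pi (setT `*` B) = pred_law XX kappa f v s B &
      (\int[pi]_z ((z.1 - z.2) ^+ 2)%:E =
       \int[kappa s v]_(x in XX) ((f x s - fstar x s) ^+ 2)%:E)%E].
Proof.
move=> mf.
pose g x : R * R := ((fstar ^~ s) \_ XX x, (f ^~ s) \_ XX x).
have m1 : measurable_fun setT ((fstar ^~ s) \_ XX).
  exact: (measurable_restrictT (fstar ^~ s) mXX).1 (mfstar s).
have m2 : measurable_fun setT ((f ^~ s) \_ XX).
  exact: (measurable_restrictT (f ^~ s) mXX).1 (mf s).
have mg : measurable_fun setT g by exact: measurable_fun_pair.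
have [pi [piE intE]] := law_exists (@prob_kernel _ _ _ _ _ (kappa s) v) mg.
have gE x : XX x -> g x = (fstar x s, f x s).
  by move=> Xx; rewrite /g !patchE mem_set.
have pA A : measurable A ->
    pi A = kappa s v (XX `&` [set x | A (fstar x s, f x s)]).
  move=> mA; rewrite piE -kappa_XX; last by rewrite -[X in measurable X]setTI; exact: mg.
  congr (kappa s v _); apply/seteqP; split => x [Xx] /=; rewrite gE//.
exists pi; split => //.
- move=> B mB; rewrite pA; last exact: measurableX.
  by congr (kappa s v _); apply/seteqP; split => x [Xx]; [case|split].
- move=> B mB; rewrite pA; last exact: measurableX.
  by congr (kappa s v _); apply/seteqP; split => x [Xx]; [case|split].
- rewrite intE; last 2 first.
  + apply/measurable_EFinP/measurable_funX/measurable_funB.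
      exact: measurable_fst.
    exact: measurable_snd.
  + by move=> z; rewrite lee_fin sqr_ge0.
  rewrite [RHS]integral_mkcond; apply: eq_integral => x _.
  rewrite patchE; case: ifPn => xX; first by rewrite (gE _ (set_mem xX)); congr EFin => /=; ring.
  by rewrite /g !patchE (negbTE xX) subrr expr0n.
Qed.

Lemma pred_law_prob f s : predictor XX f -> exists mu : probability R R,
  forall B, measurable B -> pred_law XX kappa f v s B = mu B.
Proof.
move=> /(joint_law s)[pi [_ _ h _]].
have [mu [muE _]] := law_exists (probability_setT pi) (@measurable_snd _ _ R R).
exists mu => B mB; rewrite -h// muE; congr (pi _).
by apply/seteqP; split => [z []|z].
Qed.

End conditional_laws.

(** * Averaged quantiles of non-atomic laws with bounded support *)

Section quantile_level.
Context (R : realType) (K : nat) (w : 'I_K -> R) (mu : 'I_K -> probability R R) (M : R).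
Hypotheses (w_ge0 : forall s, 0 <= w s) (w1 : \sum_s w s = 1) (M_gt0 : 0 < M).
Hypothesis mu_na : forall s, nonatomic (mu s).
Hypothesis mu_supp : forall s, supported_in (mu s) `[- M, M]%classic.
Local Notation F s := (cdf_of (mu s)).

Lemma cdf_below s t : t <= - M -> F s t = 0.
Proof.
move=> tM; apply/eqP; rewrite eq_le cdf_of_ge0 andbT -lee_fin cdf_ofE.
(* For t = - M the end point belongs to the support interval, and is removed as a non-atom. *)
have sub : `]-oo, t]%classic `<=` ~` `[- M, M]%classic `|` [set - M].
  move=> x; rewrite /= !in_itv/= => xt.
  have [->|xM] := eqVneq x (- M); [by right|left => /andP[h _]].
  by move/eqP: xM; apply; apply/eqP; rewrite eq_le h (le_trans xt).
apply: (@le_trans _ _ (mu s (~` `[- M, M]%classic `|` [set - M]))).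
  apply: le_measure; rewrite ?inE//.
  by apply: measurableU => //; exact: measurableC.
apply: (le_trans (measureU2 _ _ _)) => //; first exact: measurableC.
have e1 : mu s (~` `[- M, M]%classic) = 0%E := mu_supp s.
have e2 : mu s [set - M] = 0%E := mu_na s (- M).
by rewrite -[leRHS](adde0 0%E) -{1}e1 -e2.
Qed.

Lemma cdf_above s t : M <= t -> F s t = 1.
Proof.
move=> tM; apply/eqP; rewrite eq_le cdf_of_le1/= -lee_fin cdf_ofE.
have e1 : mu s (~` `[- M, M]%classic) = 0%E := mu_supp s.
rewrite -[leRHS]adde0 -e1 -[leLHS](probability_setT (mu s)).
apply: (@le_trans _ _ (mu s (`]-oo, t]%classic `|` ~` `[- M, M]%classic))).
  apply: le_measure; rewrite ?inE//.
    by apply: measurableU => //; exact: measurableC.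
  move=> x _; have [xt|tx] := leP x t; first by left; rewrite /= in_itv.
  by right; rewrite /= in_itv/= => /andP[_]; rewrite leNgt (le_lt_trans tM).
by apply: measureU2 => //; exact: measurableC.
Qed.

(** The subtracted quotient is the projection of t onto [-M, M], so this is the signed distance from
    t to that interval. *)
Definition stretch t : R := t - (`|t + M| - `|t - M|) / 2.

Lemma stretch_in t : - M <= t <= M -> stretch t = 0.
Proof.
move=> /andP[h1 h2]; rewrite /stretch.
rewrite (@ger0_norm _ (t + M)); last by lra.
by rewrite (@ler0_norm _ (t - M)); lra.
Qed.

Lemma stretch_below t : t <= - M -> stretch t = t + M.
Proof.
move: M_gt0 => M0 h; rewrite /stretch (@ler0_norm _ (t + M)); last by lra.
by rewrite (@ler0_norm _ (t - M)); lra.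
Qed.

Lemma stretch_above t : M <= t -> stretch t = t - M.
Proof.
move: M_gt0 => M0 h; rewrite /stretch (@ger0_norm _ (t + M)); last by lra.
by rewrite (@ger0_norm _ (t - M)); lra.
Qed.

Lemma stretch_continuous : continuous stretch.
Proof.
move=> t; apply: cvgB; first exact: cvg_id.
apply: cvgM; last exact: cvg_cst.
apply: cvgB; apply: cvg_norm.
  by apply: cvgD; [exact: cvg_id|exact: cvg_cst].
by apply: cvgB; [exact: cvg_id|exact: cvg_cst].
Qed.

Lemma stretch_nd s t : s <= t -> stretch s <= stretch t.
Proof.
move: M_gt0 => M0 st; rewrite /stretch.
case: (ger0P (s + M)); case: (ger0P (s - M)); case: (ger0P (t + M));
  case: (ger0P (t - M)); lra.
Qed.

(* Sloping the distribution function outside [-M, M] makes it a surjection of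
   R, so that every level has a preimage. *)
Definition sloped_cdf s t : R := F s t + stretch t.

(** The slope is nonpositive where F = 0, nonnegative where F = 1 and zero between, so it moves no
    superlevel set of a level in ]0, 1]. *)
Lemma level_le s t u : 0 < u -> u <= 1 -> (u <= sloped_cdf s t) = (u <= F s t).
Proof.
move: M_gt0 => M0 u0 u1; rewrite /sloped_cdf.
have [tM|Mt] := leP t (- M).
  rewrite cdf_below// stretch_below//.
  by rewrite [RHS]leNgt u0 /= leNgt; apply/negbTE; rewrite negbK; lra.
have [tM|tM] := leP M t.
  by rewrite cdf_above// stretch_above// u1; lra.
by rewrite stretch_in ?addr0// (ltW Mt) ltW.
Qed.

Lemma sloped_cdf_continuous s : continuous (sloped_cdf s).
Proof.
move=> t; apply: cvgD; first exact: cdf_of_continuous.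
exact: stretch_continuous.
Qed.

Lemma sloped_cdf_nd s x y : x <= y -> sloped_cdf s x <= sloped_cdf s y.
Proof. by move=> xy; apply: lerD; [exact: cdf_of_nd|exact: stretch_nd]. Qed.

Lemma sloped_cdf_low s u : exists t, sloped_cdf s t <= u.
Proof.
have M0 := M_gt0; exists (- M - `|u|).
rewrite /sloped_cdf cdf_below ?stretch_below; first 1 last.
- by have := normr_ge0 u; lra.
- by have := normr_ge0 u; lra.
- by have := lerNnormlW (lexx `|u|); lra.
Qed.

Lemma sloped_cdf_high s u : exists t, u <= sloped_cdf s t.
Proof.
have M0 := M_gt0; exists (M + `|u|).
rewrite /sloped_cdf cdf_above ?stretch_above; first 1 last.
- by have := normr_ge0 u; lra.
- by have := normr_ge0 u; lra.
- by have := ler_norm u; lra.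
Qed.

Lemma sloped_quantile s u : 0 < u -> u <= 1 ->
  sloped_cdf s (quantile (mu s) u) = u /\
  forall t, u <= sloped_cdf s t -> quantile (mu s) u <= t.
Proof.
move=> u0 u1; have -> : quantile (mu s) u = inf [set t | u <= sloped_cdf s t].
  by congr inf; apply/seteqP; split => t /=; rewrite level_le.
exact: (level_inf sloped_cdf_continuous sloped_cdf_nd sloped_cdf_low sloped_cdf_high).
Qed.

Lemma quantile_le s u t : 0 < u -> u <= 1 ->
  (quantile (mu s) u <= t) = (u <= F s t).
Proof.
move=> u0 u1; have [Fq qmin] := sloped_quantile s u0 u1.
rewrite -level_le//; apply/idP/idP => [qt|]; last exact: qmin.
by rewrite -[leLHS]Fq; exact: sloped_cdf_nd.
Qed.

(** The last clause links the closed form to the thresholds: for u = F_s(x) it says that the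
    averaged quantile is at most b exactly when F_s(x) <= F_s(c_s). *)
Lemma quantile_level b : exists c : 'I_K -> R,
  [/\ \sum_s w s * c s = b, forall s s', F s (c s) = F s' (c s') &
   forall s u, 0 < u -> u <= 1 ->
     (\sum_(s' < K) w s' * quantile (mu s') u <= b) = (u <= F s (c s))].
Proof.
have M0 := M_gt0.
have [p [c [cb cp hp]]] := weighted_level w_ge0 w1 sloped_cdf_continuous sloped_cdf_nd
  sloped_cdf_low sloped_cdf_high b.
exists c; split => //.
(* The level p of the sloped functions may leave [0, 1]; the value of each true distribution
   function at c_s is p clamped to [0, 1]. *)
- suff h s : F s (c s) = Num.max 0 (Num.min 1 p) by move=> s s'; rewrite !h.
  rewrite -(cp s) /sloped_cdf.
  have [tM|Mt] := leP (c s) (- M).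
    rewrite cdf_below// stretch_below// min_r; last by lra.
    by rewrite max_l//; lra.
  have [tM|tM] := leP M (c s).
    rewrite cdf_above// stretch_above// min_l; last by lra.
    by rewrite max_r.
  rewrite stretch_in ?(ltW Mt) ?(ltW tM)// addr0 min_r ?cdf_of_le1//.
  by rewrite max_r ?cdf_of_ge0.
- move=> s u u0 u1; rewrite -level_le// cp.
  (* The quantiles at level u are the least points reaching u, hence the best witnesses of
     [reachable]. *)
  apply/idP/idP => [h|/hp [c' cb' h]].
    apply/hp; exists (fun s' => quantile (mu s') u) => // s'.
    by have [->] := sloped_quantile s' u0 u1.
  apply: le_trans cb'; apply: (weighted_le w_ge0) => s'.
  by have [_] := sloped_quantile s' u0 u1; apply; exact: h.
Qed.

(** Discards the level 0, to which [quantile_level] does not apply. Beyond - M, the zeros of F form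
    part of a plateau. *)
Lemma cdf_zero_null s : (mu s).-negligible [set t | F s t <= 0].
Proof.
apply: (@negligibleS _ _ _ _ (`]-oo, - M]%classic `|`
    [set t | - M < t /\ F s t <= F s (- M)])).
  move=> t /= h; have [tM|tM] := leP t (- M); first by left; rewrite in_itv.
  by right; rewrite (@cdf_below s (- M)).
apply: negligibleU; last exact: cdf_level_null.
apply/negligibleP => //.
by apply: (etrans (esym (cdf_ofE (mu s) (- M)))); rewrite cdf_below.
Qed.

(** The two conditions can differ only to the right of c, on the plateau of F that contains c. *)
Lemma cdf_le_null s c : (mu s).-negligible [set t | (t <= c)%R != (F s t <= F s c)%R].
Proof.
apply: negligibleS (cdf_level_null (mu_na s) c) => t /=.
have [tc|ct] := leP t c; first by rewrite cdf_of_nd.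
by case: (boolP (F s t <= F s c)).
Qed.

End quantile_level.

(** * Optimality, uniqueness and comparison with the unfairness at one value v *)

Section fixed_level.
Context (R : realType) (d K : nat) (w : 'I_K -> R) (XX : set (d.-tuple R)).
Context (kappa : 'I_K -> R.-pker R ~> d.-tuple R).
Context (fstar f0 : d.-tuple R -> 'I_K -> R) (v M : R).
Hypotheses (w_gt0 : forall s, 0 < w s) (w1 : \sum_s w s = 1) (M_gt0 : 0 < M).
Hypotheses (mXX : measurable XX) (mfstar : predictor XX fstar).
Hypotheses (mf0 : predictor XX f0) (kXX : forall s, kappa s v (~` XX) = 0%E).
Local Notation mu s := (pred_law XX kappa fstar v s).
Hypothesis mu_na : forall s, nonatomic (mu s).
Hypothesis mu_supp : forall s, supported_in (mu s) `[- M, M]%classic.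
(** The closed form with v itself in place of [psi x s]; it holds almost everywhere once [kappa s v]
    is concentrated on psi = v. *)
Hypothesis f0E : forall s, (kappa s v).-negligible [set x | XX x /\
  f0 x s <> \sum_(s' < K) w s' * quantile (mu s') (cdf_of (mu s) (fstar x s))].

Implicit Types f g : d.-tuple R -> 'I_K -> R.

Lemma pred_law_ray f s b :
  pred_law XX kappa f v s `]-oo, b]%classic = kappa s v (XX `&` [set x | f x s <= b]).
Proof. by rewrite /pred_law set_itvNyc. Qed.

Lemma measurable_predictor_le f s b : predictor XX f ->
  measurable (XX `&` [set x | f x s <= b]).
Proof.
move=> mf; rewrite (_ : [set x | _] = (f ^~ s) @^-1` `]-oo, b]%classic).
  exact: mf.
by rewrite set_itvNyc.
Qed.

Lemma measurable_predictor_pair f g s (A : set (R * R)) :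
  predictor XX f -> predictor XX g -> measurable A ->
  measurable (XX `&` [set x | A (f x s, g x s)]).
Proof.
move=> mf mg mA.
have m1 := (measurable_restrictT (f ^~ s) mXX).1 (mf s).
have m2 := (measurable_restrictT (g ^~ s) mXX).1 (mg s).
have := measurable_fun_pair m1 m2 measurableT mA; rewrite setTI => mB.
rewrite [X in measurable X](_ : _ = XX `&`
    (fun x => (((f ^~ s) \_ XX) x, ((g ^~ s) \_ XX) x)) @^-1` A).
  exact: measurableI.
by apply/seteqP; split => x [Xx] /=; rewrite !patchE mem_set.
Qed.

(** [pred_law] is a bare set function; the facts on distribution functions are applied to genuine
    probabilities equal to it on measurable sets. *)
Lemma pred_law_family : exists nu : 'I_K -> probability R R,
  [/\ forall s B, measurable B -> mu s B = nu s B,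
      forall s, nonatomic (nu s),
      forall s, supported_in (nu s) `[- M, M]%classic &
      forall s, cdf_of (mu s) = cdf_of (nu s)].
Proof.
have [nu nuE] := choice (fun s => pred_law_prob mXX mfstar kXX s mfstar).
exists nu; split => // s.
- by move=> t; rewrite -nuE//; exact: mu_na.
- by rewrite /supported_in -nuE//; [exact: mu_supp|exact: measurableC].
- by apply/funext => t; rewrite /cdf_of nuE.
Qed.

Lemma f0_level_null : exists c : R -> 'I_K -> R,
  [/\ forall b, \sum_s w s * c b s = b,
      forall b s s', cdf_of (mu s) (c b s) = cdf_of (mu s') (c b s') &
      forall b s, (kappa s v).-negligible
        [set x | XX x /\ (f0 x s <= b)%R != (fstar x s <= c b s)%R]].
Proof.
have [nu [nuE nu_na nu_supp FE]] := pred_law_family.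
have QE s : quantile (mu s) = quantile (nu s) by rewrite /quantile FE.
have pull s N : (nu s).-negligible N ->
    (kappa s v).-negligible [set x | XX x /\ N (fstar x s)].
  move=> [B [mB B0 NB]]; exists (XX `&` (fstar ^~ s) @^-1` B); split.
  - exact: mfstar.
  - by rewrite -B0 -nuE.
  - by move=> x [Xx /NB].
have w_ge0 s : 0 <= w s by exact: ltW.
have [c cP] := choice (quantile_level w_ge0 w1 M_gt0 nu_na nu_supp).
exists c; split => [b|b s s'|b s]; first by have [] := cP b.
  by rewrite !FE; have [_ h _] := cP b; exact: h.
have [_ _ h] := cP b.
(* Three null events are set aside: the formula fails, the level is 0, or fstar lies on the plateau
   to the right of c. Elsewhere [quantile_level] decides. *)
have := negligibleU (f0E s) (negligibleU (pull s _ (cdf_zero_null nu_na nu_supp s))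
  (pull s _ (cdf_le_null nu_na s (c b s)))).
apply: negligibleS => x /= [Xx xorx].
have [f0x|] := pselect (f0 x s = \sum_(s' < K) w s' * quantile (mu s') (cdf_of (mu s) (fstar x s))); last by left.
have [F0|F0] := leP (cdf_of (nu s) (fstar x s)) 0; first by right; left.
right; right; split => //; move: xorx; rewrite f0x FE.
under eq_bigr do rewrite QE.
by rewrite (h s)// ?cdf_of_le1// eq_sym.
Qed.

Lemma mass_fst_pred (pi : probability (R * R)%type R) f g s c :
  (forall A, measurable A -> pi A = kappa s v (XX `&` [set x | A (f x s, g x s)])) ->
  mass_fst pi c = cdf_of (pred_law XX kappa f v s) c.
Proof.
move=> piE; rewrite /mass_fst /cdf_of pred_law_ray piE//.
by have := measurable_fst_le c measurableT (Y := [set true]); rewrite setTI; apply.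
Qed.

Lemma mass_snd_pred (pi : probability (R * R)%type R) f g s c :
  (forall A, measurable A -> pi A = kappa s v (XX `&` [set x | A (f x s, g x s)])) ->
  mass_snd pi c = cdf_of (pred_law XX kappa g v s) c.
Proof.
move=> piE; rewrite /mass_snd /cdf_of pred_law_ray piE//.
by have := measurable_snd_le c measurableT (Y := [set true]); rewrite setTI; apply.
Qed.

Lemma optimal_coupling : exists (pi0 : 'I_K -> probability (R * R)%type R) (c : R -> 'I_K -> R),
  [/\ (forall s A, measurable A ->
         pi0 s A = kappa s v (XX `&` [set x | A (fstar x s, f0 x s)])) /\
       total_cost w pi0 = risk_at w XX kappa fstar f0 v,
      forall b, \sum_s w s * c b s = b,
      forall b s s', mass_fst (pi0 s) (c b s) = mass_fst (pi0 s') (c b s'),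
      forall b s, (pi0 s).-negligible [set z | (z.2 <= b)%R != (z.1 <= c b s)%R] &
      forall b s, (kappa s v).-negligible
        [set x | XX x /\ (f0 x s <= b)%R != (fstar x s <= c b s)%R]].
Proof.
have [pi0 pi0P] := choice (fun s => joint_law mXX mfstar kXX s mf0).
have [c [cb cF c0]] := f0_level_null.
exists pi0, c; split => //.
- split; first by move=> s A mA; have [h _ _ _] := pi0P s; exact: h.
  by apply: eq_bigr => s _; have [_ _ _ ->] := pi0P s.
- move=> b s s'; have [h _ _ _] := pi0P s; have [h' _ _ _] := pi0P s'.
  by rewrite (mass_fst_pred _ h) (mass_fst_pred _ h').
- move=> b s; have [h _ _ _] := pi0P s.
  have mA : measurable [set z : R * R | (z.2 <= b)%R != (z.1 <= c b s)%R].
    by have := measurable_xor b (c b s) measurableT (Y := [set true]); rewrite setTI; apply.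
  apply/negligibleP => //; apply: (etrans (h _ mA)); apply/negligibleP; last exact: c0.
  exact: (measurable_predictor_pair s mfstar mf0 mA).
Qed.

(** The distribution function of f0 at t is F_s(c_s) for the thresholds of level t, a number that
    does not depend on s. *)
Lemma f0_fair_at s s' B : measurable B ->
  pred_law XX kappa f0 v s B = pred_law XX kappa f0 v s' B.
Proof.
move=> mB; have [pi0 [c [[pE _] cb cm c0 _]]] := optimal_coupling.
have [m1 m1E] := pred_law_prob mXX mfstar kXX s mf0.
have [m2 m2E] := pred_law_prob mXX mfstar kXX s' mf0.
rewrite m1E// m2E//; apply: cdf_of_inj => // t.
have -> : cdf_of m1 t = mass_snd (pi0 s) t.
  by rewrite (mass_snd_pred _ (pE s)) /cdf_of m1E.
have -> : cdf_of m2 t = mass_snd (pi0 s') t.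
  by rewrite (mass_snd_pred _ (pE s')) /cdf_of m2E.
by rewrite !(mass_snd_pi0 c0) (cm t s s').
Qed.

Definition fair_at (f : d.-tuple R -> 'I_K -> R) :=
  forall (s s' : 'I_K) (B : set R), measurable B ->
    pred_law XX kappa f v s B = pred_law XX kappa f v s' B.

Lemma risk_at_le g : predictor XX g -> fair_at g ->
  (risk_at w XX kappa fstar f0 v <= risk_at w XX kappa fstar g v)%E.
Proof.
move=> mg gfair; have [pi0 [c [[pE <-] cb cm c0 _]]] := optimal_coupling.
have [pi piP] := choice (fun s => joint_law mXX mfstar kXX s mg).
have -> : risk_at w XX kappa fstar g v = total_cost w pi.
  by apply: eq_bigr => s _; have [_ _ _ ->] := piP s.
apply: (total_cost_le w_gt0 w1 _ _ cb cm c0).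
- move=> s B mB; have [_ -> //_ _] := piP s; rewrite pE; last exact: measurableX.
  by congr (kappa s v _); apply/seteqP; split => x [Xx]; [split|case].
- move=> s s' b; have [h _ _ _] := piP s; have [h' _ _ _] := piP s'.
  by rewrite (mass_snd_pred _ h) (mass_snd_pred _ h') /cdf_of (gfair s s').
Qed.

(** The zero predictor is fair and its risk is at most M^2 by the support condition. Uniqueness
    needs this finiteness. *)
Lemma risk_at_bounded : (risk_at w XX kappa fstar f0 v <= (M ^+ 2)%:E)%E.
Proof.
have m0 : predictor XX (fun (_ : d.-tuple R) (_ : 'I_K) => 0 : R).
  move=> s; have h : measurable_fun XX (cst (0 : R)) by exact: measurable_cst.
  exact: h.
have fair0 : fair_at (fun _ _ => 0).
  move=> s s' B mB; rewrite /pred_law.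
  have [B0|B0] := pselect (B 0).
    have E (s1 : 'I_K) : kappa s1 v (XX `&` (fun _ : d.-tuple R => 0) @^-1` B) = 1%E.
      rewrite (_ : _ @^-1` _ = setT); last by apply/seteqP; split.
      by rewrite (kappa_XX mXX kXX)// prob_kernel.
    by rewrite !E.
  by rewrite (_ : _ @^-1` _ = set0) ?setI0 ?measure0//; apply/seteqP; split.
apply: (le_trans (risk_at_le m0 fair0)).
apply: (@le_trans _ _ (\sum_(s < K) (w s)%:E * (M ^+ 2)%:E)%E); last first.
  by rewrite (eq_bigr (fun s => (w s * M ^+ 2)%:E))// sumEFin -mulr_suml w1 mul1r.
apply: lee_sum => s _; rewrite lee_pmul2l ?lte_fin//.
apply: (@le_trans _ _ (\int[kappa s v]_(x in XX) (M ^+ 2)%:E)%E); last first.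
  by rewrite integral_cst//= -(setIT XX) (kappa_XX mXX kXX)// prob_kernel mule1.
have msq : measurable_fun XX (fun x => ((0 - fstar x s) ^+ 2)%:E).
  have mB : measurable_fun XX (fun x => 0 - fstar x s).
    by apply: measurable_funB; [exact: m0|exact: mfstar].
  by apply/measurable_EFinP; exact: measurable_funX.
apply: ae_ge0_le_integral => //.
- by move=> x _; rewrite lee_fin sqr_ge0.
- by move=> x _; rewrite lee_fin sqr_ge0.
exists (XX `&` (fstar ^~ s) @^-1` (~` `[- M, M]%classic)); split.
- by apply: mfstar => //; exact: measurableC.
- exact: mu_supp.
- move=> x /= /not_implyP[Xx h]; split => //.
  rewrite in_itv/= => /andP[h1 h2]; apply: h.
  by rewrite lee_fin sub0r sqrrN -ler_sqrt ?sqr_ge0// !sqrtr_sqr ler_norml; 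
     rewrite (gtr0_norm M_gt0) h1.
Qed.

(** A candidate target m is the common second marginal of couplings of the laws of fstar, so the
    comparison applies to them directly. *)
Lemma risk_at_le_unfairness :
  (risk_at w XX kappa fstar f0 v <= unfairness_at w XX kappa fstar v)%E.
Proof.
have [pi0 [c [[pE <-] cb cm c0 _]]] := optimal_coupling.
apply: le_ereal_inf_tmp => _ [m _ <-].
set I := fun s => ereal_inf [set (\int[pi]_z ((z.1 - z.2) ^+ 2)%:E)%E
  | pi in couplings (mu s) m].
have I0 s : (0 <= I s)%E.
  apply: le_ereal_inf_tmp => _ [pi _ <-]; apply: integral_ge0 => z _.
  by rewrite lee_fin sqr_ge0.
rewrite (eq_bigr (fun s => (w s)%:E * I s)%E); last first.
  move=> s _; rewrite /W2 sqr_sqrte; first by [].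
  exact: I0.
have [[s Is]|Ifin] := pselect (exists s, I s = +oo%E).
  rewrite (bigD1 s)//= Is gt0_muley ?lte_fin// addye ?leey//.
  rewrite gt_eqF// (lt_le_trans ltNy0)//.
  by apply: sume_ge0 => i _; rewrite mule_ge0// lee_fin ltW.
(* The infimum over couplings need not be attained here: each s gets a coupling within e, and the
   total error is e since the weights sum to 1. *)
apply/lee_addgt0Pr => e e0.
have near_opt s : exists pi, couplings (mu s) m pi /\
    (\int[pi]_z ((z.1 - z.2) ^+ 2)%:E <= I s + e%:E)%E.
  have Is : I s \is a fin_num.
    rewrite ge0_fin_numE// ltey; apply/eqP => h; apply: Ifin.
    by exists s.
  have [_ [pi cpi <-] h] := lb_ereal_inf_adherent e0 Is.
  by exists pi; split => //; exact: ltW.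
have [pi piP] := choice near_opt.
have : (total_cost w pi0 <= total_cost w pi)%E.
  apply: (total_cost_le w_gt0 w1 _ _ cb cm c0).
  - move=> s B mB; have [h _] := piP s; rewrite (h B mB).1 pE; last exact: measurableX.
    by congr (kappa s v _); apply/seteqP; split => x [Xx]; [split|case].
  - move=> s s' b; have [h _] := piP s; have [h' _] := piP s'.
    rewrite /mass_snd (_ : [set z : R * R | z.2 <= b] = setT `*` `]-oo, b]%classic).
      by rewrite (h _ _).2// (h' _ _).2.
    by rewrite set_itvNyc; apply/seteqP; split => z // -[].
move=> /le_trans; apply.
apply: (@le_trans _ _ (\sum_(s < K) (w s)%:E * (I s + e%:E))%E).
  by apply: lee_sum => s _; rewrite lee_pmul2l ?lte_fin//; exact: (piP s).2.
rewrite (eq_bigr (fun s => (w s)%:E * I s + (w s * e)%:E)%E); last first.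
  by move=> s _; rewrite ge0_muleDr ?lee_fin ?(ltW e0).
by rewrite big_split/= sumEFin -mulr_suml w1 mul1r.
Qed.

(** At almost every level b, g and f0 fall below b on the same event up to a null set. Countably
    many such levels, one in each rational interval, separate any two distinct values. *)
Lemma risk_at_eq g : predictor XX g -> fair_at g ->
  (risk_at w XX kappa fstar g v <= risk_at w XX kappa fstar f0 v)%E ->
  forall s, (kappa s v).-negligible [set x | XX x /\ g x s <> f0 x s].
Proof.
move=> mg gfair; have fin := le_lt_trans risk_at_bounded (ltry _).
have [pi0 [c [[pE costE] cb cm c0 c0']]] := optimal_coupling.
rewrite -costE in fin *.
have [pi piP] := choice (fun s => joint_law mXX mfstar kXX s mg).
have -> : risk_at w XX kappa fstar g v = total_cost w pi.
  by apply: eq_bigr => s _; have [_ _ _ ->] := piP s.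
move=> cost_le s.
have [N [mN N0 hN]] : {ae lebesgue_measure, forall b s, excess (pi s) b (c b s) = 0%E}.
  apply: (total_cost_eq w_gt0 w1 _ _ cb cm c0) => //.
  - move=> s1 B mB; have [_ -> //_ _] := piP s1; rewrite pE; last exact: measurableX.
    by congr (kappa s1 v _); apply/seteqP; split => x [Xx]; [split|case].
  - move=> s1 s' b; have [h _ _ _] := piP s1; have [h' _ _ _] := piP s'.
    by rewrite (mass_snd_pred _ h) (mass_snd_pred _ h') /cdf_of (gfair s1 s').
(* The null set N of bad levels cannot contain an open interval; the witness 0 is a dummy for pairs
   in the wrong order. *)
have pick (qr : rat * rat) : exists b, (ratr qr.1 < ratr qr.2 :> R) ->
    (ratr qr.1 < b < ratr qr.2 /\ ~ N b).
  have [qr_lt|] := boolP (ratr qr.1 < ratr qr.2 :> R); last by exists 0.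
  have [//|none] := pselect (exists b, ratr qr.1 < b < ratr qr.2 /\ ~ N b).
    by move=> [b hb]; exists b.
  have sub : `]ratr qr.1, ratr qr.2[%classic `<=` N.
    move=> b /=; rewrite in_itv/= => hb.
    by apply: contrapT => Nb; apply: none; exists b.
  have : (lebesgue_measure (`]ratr qr.1, ratr qr.2[%classic : set R) <= 0)%E.
    by rewrite -N0; apply: le_measure; rewrite ?inE.
  by rewrite lebesgue_measure_itv/= lte_fin qr_lt -EFinB lee_fin; lra.
have [b bP] := choice pick.
have bad qr : (kappa s v).-negligible [set x | XX x /\
    ratr qr.1 < ratr qr.2 :> R /\ (g x s <= b qr)%R != (f0 x s <= b qr)%R].
  have [qr_lt|nlt] := boolP (ratr qr.1 < ratr qr.2 :> R); last first.
    apply: (@negligibleS _ _ _ _ set0); last exact: negligible_set0.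
    by move=> x [_ []].
  have [_ Nb] := bP qr qr_lt.
  have ex0 : excess (pi s) (b qr) (c (b qr) s) = 0%E.
    by apply: contrapT => h; apply/Nb/hN => /(_ s).
  have piN : (pi s).-negligible [set z | (z.2 <= b qr)%R != (z.1 <= c (b qr) s)%R].
    apply: excess_eq0 ex0 => t.
    have [_ h _ _] := piP s; have := mu_na s t; rewrite -h// => <-.
    by congr (pi s _); apply/seteqP; split => z // -[].
  have mA : measurable [set z : R * R | (z.2 <= b qr)%R != (z.1 <= c (b qr) s)%R].
    by have := measurable_xor (b qr) (c (b qr) s) measurableT (Y := [set true]); rewrite setTI; apply.
  have gN : (kappa s v).-negligible
      [set x | XX x /\ (g x s <= b qr)%R != (fstar x s <= c (b qr) s)%R].
    have [h _ _ _] := piP s.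
    apply/negligibleP; first exact: (measurable_predictor_pair s mfstar mg mA).
    by have /negligibleP := piN => /(_ mA) <-; apply: esym; exact: h.
  apply: negligibleS (negligibleU gN (c0' (b qr) s)) => x [Xx [_ h]].
  have [e|e] := eqVneq (g x s <= b qr) (fstar x s <= c (b qr) s).
    by right; split => //; rewrite eq_sym -e.
  by left.
apply: negligibleS (negligible_bigcup_count bad) => x [Xx gf].
have sep (y z : R) : y < z -> exists qr : rat * rat,
    (ratr qr.1 < ratr qr.2 :> R) /\ y < ratr qr.1 /\ ratr qr.2 < z.
  move=> /rat_in_itvoo[q]; rewrite in_itv/= => /andP[yq qz].
  have [r] := rat_in_itvoo qz; rewrite in_itv/= => /andP[qr rz].
  by exists (q, r).
have [lt_gf|lt_fg|] := ltgtP (g x s) (f0 x s); last by move/gf.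
  have [qr [h1 [h2 h3]]] := sep _ _ lt_gf; exists qr => //; split => //; split => //.
  have [/andP[h4 h5] _] := bP qr h1.
  by rewrite (ltW (lt_trans h2 h4)) leNgt (lt_trans h5 h3).
have [qr [h1 [h2 h3]]] := sep _ _ lt_fg; exists qr => //; split => //; split => //.
have [/andP[h4 h5] _] := bP qr h1.
by rewrite (ltW (lt_trans h2 h4)) leNgt (lt_trans h5 h3).
Qed.

End fixed_level.

(** * Measurability of the barycentric predictor *)

Section measurable_f0star.
Context (R : realType) (d K : nat) (w : 'I_K -> R) (XX : set (d.-tuple R)).
Context (kappa : 'I_K -> R.-pker R ~> d.-tuple R).
Context (psi fstar : d.-tuple R -> 'I_K -> R) (M : R).
Hypotheses (mXX : measurable XX) (mfstar : predictor XX fstar).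
Hypotheses (mpsi : predictor XX psi) (M_gt0 : 0 < M).
Hypothesis psi01 : forall x s, XX x -> psi x s \in `[0, 1].
Hypothesis kXX : forall s v, v \in `[0, 1] -> kappa s v (~` XX) = 0%E.
Hypothesis na : forall v s, v \in `[0, 1] -> nonatomic (pred_law XX kappa fstar v s).
Hypothesis supp : forall v s, v \in `[0, 1] ->
  supported_in (pred_law XX kappa fstar v s) `[- M, M]%classic.
Local Notation F v s := (cdf_of (pred_law XX kappa fstar v s)).

Lemma measurable_cdf_psi s s' t : measurable_fun XX (fun x => F (psi x s) s' t).
Proof.
have mU : measurable (XX `&` [set x | fstar x s' <= t]).
  exact: measurable_predictor_le.
have mF : measurable_fun setT (fun v => F v s' t).
  rewrite (_ : (fun _ => _) = (fun v => fine (kappa s' v (XX `&` [set x | fstar x s' <= t])))).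
    apply: measurableT_comp; first exact: fine_measurable.
    exact: measurable_kernel.
  by apply/funext => v; rewrite /cdf_of pred_law_ray.
exact: (measurableT_comp mF (mpsi s)).
Qed.

Definition level x s : R := F (psi x s) s (fstar x s).

(** By monotonicity and right continuity, F(fstar) < a exactly when F(q) < a for some rational q >
    fstar, which replaces the random argument of F by constants. *)
Lemma measurable_level s : measurable_fun XX (level ^~ s).
Proof.
apply: (measurability _ (RGenInftyO.measurableE R)).
move=> /= _ [_ [a ->] <-].
rewrite (_ : _ `&` _ = \bigcup_(q : rat) ((XX `&` (fstar ^~ s) @^-1` `]-oo, ratr q[%classic) `&`
    (XX `&` (fun x => F (psi x s) s (ratr q)) @^-1` `]-oo, a[%classic))).
  apply: bigcupT_measurable_rat => q; apply: measurableI.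
    exact: mfstar.
  exact: measurable_cdf_psi.
apply/seteqP; split => [x [Xx]|x [q _ [[Xx]]]] /=; rewrite !in_itv/=; last first.
  move=> fq [_ Fq]; split => //; apply: le_lt_trans Fq.
  have v01 := psi01 s Xx.
  have [nu [_ _ _ FE]] := pred_law_family mXX mfstar (fun s => kXX s v01)
    (fun s => na s v01) (fun s => supp s v01).
  by rewrite /level FE; apply: cdf_of_nd; exact: ltW.
have v01 := psi01 s Xx.
have [nu [_ nu_na _ FE]] := pred_law_family mXX mfstar (fun s => kXX s v01)
    (fun s => na s v01) (fun s => supp s v01).
rewrite /level FE => Fa.
have e0 : 0 < (a - cdf_of (nu s) (fstar x s)) / 2 by lra.
have [e e_gt0 he] := cdf_of_right (nu s) (fstar x s) e0.
have /rat_in_itvoo[q] : fstar x s < fstar x s + e by lra.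
rewrite in_itv/= => /andP[q1 q2]; exists q => //; split; split => //=.
rewrite in_itv/= FE.
by have := cdf_of_nd (nu s) (ltW q2); lra.
Qed.

(** At a positive level, a < quantile means F(a) < level. At level 0 the superlevel set is all of R
    and the quantile takes the default value [inf setT], a constant, so the event is still
    measurable. *)
Lemma measurable_quantile_level s s' : measurable_fun XX
  (fun x => quantile (pred_law XX kappa fstar (psi x s) s') (level x s)).
Proof.
have mF t := measurable_cdf_psi s s' t.
have ml := measurable_level s.
apply: (measurability _ (RGenOInfty.measurableE R)).
move=> /= _ [_ [a ->] <-].
rewrite (_ : _ `&` _ =
   (XX `&` (level ^~ s) @^-1` `]-oo, 0]%classic) `&` (if a < inf (@setT R) then setT else set0) `|`
   (XX `&` (level ^~ s) @^-1` `]0, +oo[%classic) `&`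
   (XX `&` (fun x => level x s - F (psi x s) s' a) @^-1` `]0, +oo[%classic)).
  apply: measurableU; apply: measurableI.
  - exact: ml.
  - by case: ifPn.
  - exact: ml.
  - by apply: measurable_funB.
have key x : XX x ->
    (a < quantile (pred_law XX kappa fstar (psi x s) s') (level x s)) =
    if level x s <= 0 then a < inf (@setT R) else F (psi x s) s' a < level x s.
  move=> Xx; have v01 := psi01 s Xx.
  have [nu [_ nu_na nu_supp FE]] := pred_law_family mXX mfstar (fun s => kXX s v01)
      (fun s => na s v01) (fun s => supp s v01).
  have [l0|l0] := leP (level x s) 0.
    congr (_ < inf _); apply/seteqP; split => // t _ /=.
    by rewrite FE (le_trans l0)// cdf_of_ge0.
  rewrite /quantile FE ltNge [RHS]ltNge; congr (~~ _).
  apply: (@quantile_le _ _ nu M) => //.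
  by rewrite /level FE cdf_of_le1.
apply/seteqP; split => [x [Xx]|x] /=; rewrite !in_itv/= !andbT.
  rewrite key//; case: ifPn => l0 h; [left|right].
    by split => //; rewrite h.
  by rewrite ltNge l0 subr_gt0.
case=> [[[Xx l0] h]|[[Xx l0] [_ h]]]; split => //; rewrite key//.
  by rewrite l0; move: h; case: ifPn.
by rewrite leNgt l0/= -subr_gt0.
Qed.

Lemma predictor_f0star : predictor XX (f0star w XX kappa psi fstar).
Proof.
move=> s; apply: measurable_sum => s'.
apply: measurable_funM => //.
exact: measurable_quantile_level.
Qed.

End measurable_f0star.

(** * Almost every value of V *)

(* Applied to the unfairness at v, an infimum over an uncountable family whose
   measurability in v is unclear. *)
Lemma ge0_le_integral_outer d (T : measurableType d) (R : realType)
    (mu : {measure set T -> \bar R}) (D E : set T) (f g : T -> \bar R) :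
  D `<=` E -> (forall x, D x -> 0 <= f x)%E -> (forall x, E x -> 0 <= g x)%E ->
  (forall x, D x -> f x <= g x)%E ->
  (\int[mu]_(x in D) f x <= \int[mu]_(x in E) g x)%E.
Proof.
move=> DE f0 g0 fg; rewrite !ge0_integralE//; apply: le_ereal_sup => _ [h hf <-].
exists h => // x; apply: le_trans (hf x) _; rewrite !patchE.
case: ifPn => [/set_mem Dx|_]; first by rewrite mem_set ?fg//; exact: DE.
by case: ifPn => // /set_mem; exact: g0.
Qed.

Lemma ae_forall_count d (T : measurableType d) (R : realType)
    (mu : {measure set T -> \bar R}) (I : countType) (Q : I -> T -> Prop) :
  (forall i, {ae mu, forall x, Q i x}) -> {ae mu, forall x, forall i, Q i x}.
Proof.
move=> h; apply: negligibleS (negligible_bigcup_count h) => x /= /existsNP[i Qi].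
by exists i.
Qed.

Lemma ae_mp2 d (T : measurableType d) (R : realType)
    (mu : {measure set T -> \bar R}) (A B C : T -> Prop) :
  {ae mu, forall x, A x} -> {ae mu, forall x, B x} ->
  (forall x, A x -> B x -> C x) -> {ae mu, forall x, C x}.
Proof. by move=> hA hB hC; apply: filterS2 hA hB. Qed.

Lemma measurable_risk_at (R : realType) (d K : nat) (w : 'I_K -> R)
    (XX : set (d.-tuple R)) (kappa : 'I_K -> R.-pker R ~> d.-tuple R)
    (fstar f : d.-tuple R -> 'I_K -> R) :
  measurable XX -> predictor XX fstar -> predictor XX f ->
  measurable_fun setT (risk_at w XX kappa fstar f).
Proof.
move=> mXX mfstar mf; apply: emeasurable_sum => s; apply: measurable_funeM.
pose h := (fun x => ((f x s - fstar x s) ^+ 2)%:E) \_ XX.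
rewrite (_ : (fun _ => _) = (fun v => \int[kappa s v]_x h x)%E); last first.
  by apply/funext => v; rewrite [LHS]integral_mkcond.
apply: measurable_fun_integral_kernel.
- by move=> U mU; exact: measurable_kernel.
- by move=> x; rewrite /h patchE; case: ifPn => // _; rewrite lee_fin sqr_ge0.
- apply/(measurable_restrictT _ mXX).
  apply/measurable_EFinP; apply: measurable_funX.
  by apply: measurable_funB; [exact: mf|exact: mfstar].
Qed.

Lemma risk_at_ge0 (R : realType) (d K : nat) (w : 'I_K -> R)
    (XX : set (d.-tuple R)) (kappa : 'I_K -> R.-pker R ~> d.-tuple R)
    (fstar f : d.-tuple R -> 'I_K -> R) v :
  (forall s, 0 <= w s) -> (0 <= risk_at w XX kappa fstar f v)%E.
Proof.
move=> w0; apply: sume_ge0 => s _; rewrite mule_ge0 ?lee_fin//.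
by apply: integral_ge0 => x _; rewrite lee_fin sqr_ge0.
Qed.

Lemma unfairness_at_ge0 (R : realType) (d K : nat) (w : 'I_K -> R)
    (XX : set (d.-tuple R)) (kappa : 'I_K -> R.-pker R ~> d.-tuple R)
    (f : d.-tuple R -> 'I_K -> R) v :
  (forall s, 0 <= w s) -> (0 <= unfairness_at w XX kappa f v)%E.
Proof.
move=> w0; apply: le_ereal_inf_tmp => _ [mu _ <-]; apply: sume_ge0 => s _.
by rewrite mule_ge0 ?lee_fin// expe_ge0// sqrte_ge0.
Qed.

Lemma measurable_disagreement (R : realType) (d K : nat) (XX : set (d.-tuple R))
    (f g : d.-tuple R -> 'I_K -> R) s :
  measurable XX -> predictor XX f -> predictor XX g ->
  measurable (XX `&` [set x | f x s != g x s]).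
Proof.
move=> mXX mf mg.
have mb : measurable_fun XX (fun x => ~~ (f x s == g x s)).
  by apply: measurable_neg; apply: measurable_fun_eqr; [exact: mf|exact: mg].
exact: (mb mXX [set true]).
Qed.

(** * Passing between events of the model and almost every v *)

Section model.
Context (R : realType) (d K : nat) (d0 : measure_display).
Context (Omega : measurableType d0) (P : probability Omega R).
Context (XX : set (d.-tuple R)) (X : {RV P >-> d.-tuple R}) (V : {RV P >-> R}).
Context (S : Omega -> 'I_K) (psi : d.-tuple R -> 'I_K -> R).
Context (kappa : 'I_K -> R.-pker R ~> d.-tuple R).
Hypotheses (mXX : measurable XX) (X_in : forall o, XX (X o)).
Hypothesis V01 : forall o, V o \in `[0, 1].
Hypothesis mS : forall s, measurable (S @^-1` [set s]).
Hypothesis w_gt0 : forall s, 0 < weight P S s.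
Hypothesis Vunif : forall A : set R, measurable A -> distribution P V A = unif01 R A.
Hypothesis VS : indep_of_index P V S.
Hypothesis mpsi : predictor XX psi.
Hypothesis Vpsi : {ae P, forall o, V o = psi (X o) (S o)}.
Hypothesis kappaP : cond_law P XX X V S kappa.

Lemma weightE s : (weight P S s)%:E = P (S @^-1` [set s]).
Proof. by rewrite /weight fineK// fin_num_measure. Qed.

Lemma sum_weight : \sum_s weight P S s = 1.
Proof.
apply: EFin_inj; rewrite -sumEFin -(probability_setT P).
have -> : [set: Omega] = \big[setU/set0]_(s < K) (S @^-1` [set s]).
  by apply/seteqP; split => // o _; rewrite (bigD1 (S o))//=; left.
rewrite measure_bigsetU_ord//; first by apply: eq_bigr => s _; exact: weightE.
by apply/trivIsetP => s s' _ _ ss'; apply/seteqP; split => // o [/= So So'];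
  move: ss'; rewrite -So -So' eqxx.
Qed.

Lemma unif01_out : unif01 R (~` `[0, 1]%classic) = 0%E.
Proof.
rewrite -Vunif; last exact: measurableC.
rewrite /distribution /pushforward (_ : _ @^-1` _ = set0) ?measure0//.
by apply/seteqP; split => // o; have /= := V01 o; rewrite /= => h; apply.
Qed.

Lemma measurable_V A : measurable A -> measurable (V @^-1` A).
Proof. by move=> mA; rewrite -[X in measurable X]setTI; exact: measurable_funP. Qed.

Lemma measurable_X B : measurable B -> measurable (X @^-1` B).
Proof. by move=> mB; rewrite -[X in measurable X]setTI; exact: measurable_funP. Qed.

Lemma P_VS A s : measurable A ->
  P (S @^-1` [set s] `&` V @^-1` A) = ((weight P S s)%:E * unif01 R A)%E.
Proof. by move=> mA; rewrite setIC VS// weightE muleC -Vunif. Qed.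

Lemma P_kappa s A B : measurable A -> measurable B ->
  P ((S @^-1` [set s] `&` V @^-1` A) `&` X @^-1` B) =
  (\int[P]_(o in S @^-1` [set s] `&` V @^-1` A) kappa s (V o) B)%E.
Proof.
move=> mA mB; have [_ kP] := kappaP.
pose A' s' := if s' == s then A else set0.
have := kP A' B _ mB.
have -> : [set o | A' (S o) (V o)] = S @^-1` [set s] `&` V @^-1` A.
  apply/seteqP; split => o; rewrite /A' /=.
    by case: eqP.
  by case=> -> Ao; rewrite eqxx.
move=> ->; last by move=> s'; rewrite /A'; case: ifP.
by apply: eq_integral => o /set_mem[/= -> _].
Qed.

(** By independence the law of V on the event S = s is w_s times the uniform law; as w_s > 0, a set
    of values v that is null on this event is null for the uniform law. *)
Lemma kappa_null s A B : measurable A -> measurable B ->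
  P ((S @^-1` [set s] `&` V @^-1` A) `&` X @^-1` B) = 0%E ->
  {ae unif01 R, forall v, A v -> kappa s v B = 0%E}.
Proof.
move=> mA mB; rewrite P_kappa// => int0.
have mD : measurable (S @^-1` [set s] `&` V @^-1` A).
  by apply: measurableI => //; exact: measurable_V.
have mk : measurable_fun setT (fun v => kappa s v B) by exact: measurable_kernel.
have mkV : measurable_fun (S @^-1` [set s] `&` V @^-1` A) (fun o => kappa s (V o) B).
  by apply: measurable_funTS; exact: (measurableT_comp mk (measurable_funPT V)).
pose N := A `&` [set v | kappa s v B != 0%E].
have mN : measurable N.
  apply: measurableI => //; rewrite -[X in measurable X]setTI.
  exact: emeasurable_neq.
have /(ae_eq_integral_abs P mD mkV) ae0 :
    (\int[P]_(o in S @^-1` [set s] `&` V @^-1` A) `|kappa s (V o) B|)%E = 0%E.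
  by rewrite -int0; apply: eq_integral => o _; rewrite gee0_abs.
have : P (S @^-1` [set s] `&` V @^-1` N) = 0%E.
  apply/(negligibleP P).
    by apply: measurableI => //; exact: measurable_V.
  apply: negligibleS ae0 => o /= [So [AVo kV]] h.
  by move/eqP: kV; apply; exact: h.
rewrite P_VS// => /eqP; rewrite mule_eq0 eqe gt_eqF//= => /eqP N0.
exists N; split => // v /= /not_implyP[Av kv]; split => //; exact/eqP.
Qed.

Lemma kappa_null_inv s B : measurable B ->
  {ae unif01 R, forall v, kappa s v B = 0%E} ->
  P (S @^-1` [set s] `&` X @^-1` B) = 0%E.
Proof.
move=> mB [N [mN N0 hN]].
have := P_kappa s measurableT mB; rewrite preimage_setT setIT => ->.
have mk : measurable_fun setT (fun v => kappa s v B) by exact: measurable_kernel.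
rewrite (@ae_eq_integral _ _ _ P (S @^-1` [set s]) (cst 0%E)) ?integral0//.
  by apply: measurable_funTS; exact: (measurableT_comp mk (measurable_funPT V)).
exists (V @^-1` N); split; first exact: measurable_V.
  by rewrite -N0 -Vunif.
by move=> o /= /not_implyP[_ h]; exact: hN.
Qed.

(** If psi differs from v, a rational q satisfies v <= q < psi or psi <= q < v. For each q these
    events contradict V = psi, so [kappa_null] applies, and only countably many exceptional sets of
    v arise. *)
Lemma kappa_psi s : {ae unif01 R, forall v,
  (kappa s v).-negligible [set x | XX x /\ psi x s <> v]}.
Proof.
have mlt q : measurable (XX `&` [set x | ratr q < psi x s]).
  rewrite (_ : [set x | _] = (psi ^~ s) @^-1` `]ratr q, +oo[%classic); first exact: mpsi.
  by rewrite set_itvoy.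
have mle q : measurable (XX `&` [set x | psi x s <= ratr q]).
  exact: measurable_predictor_le.
have h1 : {ae unif01 R, forall v, forall q : rat, v <= ratr q ->
    kappa s v (XX `&` [set x | ratr q < psi x s]) = 0%E}.
  apply: ae_forall_count => q.
  have := @kappa_null s `]-oo, ratr q]%classic _ (measurable_itv _) (mlt q).
  rewrite set_itvNyc; apply; apply/(negligibleP P).
    apply: measurableI; last exact: measurable_X.
    apply: measurableI => //; apply: measurable_V; rewrite -set_itvNyc.
    exact: measurable_itv.
  apply: negligibleS Vpsi => o /= [[So Vq] [_ qpsi]] h.
  by move: qpsi; rewrite -So -h ltNge Vq.
have h2 : {ae unif01 R, forall v, forall q : rat, ratr q < v ->
    kappa s v (XX `&` [set x | psi x s <= ratr q]) = 0%E}.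
  apply: ae_forall_count => q.
  have := @kappa_null s `]ratr q, +oo[%classic _ (measurable_itv _) (mle q).
  rewrite set_itvoy; apply; apply/(negligibleP P).
    apply: measurableI; last exact: measurable_X.
    apply: measurableI => //; apply: measurable_V; rewrite -set_itvoy.
    exact: measurable_itv.
  apply: negligibleS Vpsi => o /= [[So Vq] [_ qpsi]] h.
  by move: qpsi; rewrite -So -h leNgt Vq.
apply: (ae_mp2 h1 h2) => v v1 v2.
have n1 (q : rat) : (kappa s v).-negligible
    (if v <= ratr q then XX `&` [set x | ratr q < psi x s] else set0).
  case: ifPn => h; last exact: negligible_set0.
  by apply/negligibleP => //; exact: v1.
have n2 (q : rat) : (kappa s v).-negligible
    (if ratr q < v then XX `&` [set x | psi x s <= ratr q] else set0).
  case: ifPn => h; last exact: negligible_set0.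
  by apply/negligibleP => //; exact: v2.
apply: negligibleS (negligibleU (negligible_bigcup_count n1)
  (negligible_bigcup_count n2)) => x [Xx].
have [pv|vp|//] := ltgtP (psi x s) v => _.
  have /rat_in_itvoo[q] := pv; rewrite in_itv/= => /andP[q1 q2].
  by right; exists q => //; rewrite q2; split => //=; exact: ltW.
have /rat_in_itvoo[q] := vp; rewrite in_itv/= => /andP[q1 q2].
by left; exists q => //; rewrite (ltW q1).
Qed.

End model.

Theorem proposition2 (R : realType) (d K : nat)
  (d0 : measure_display) (Omega : measurableType d0) (P : probability Omega R)
  (XX : set (d.-tuple R)) (mXX : measurable XX)
  (X : {RV P >-> d.-tuple R}) (X_in : forall o, XX (X o))
  (V : {RV P >-> R}) (V01 : forall o, V o \in `[0, 1])
  (S : Omega -> 'I_K) (mS : forall s, measurable (S @^-1` [set s]))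
  (Y : {RV P >-> R})
  (w_gt0 : forall s, 0 < weight P S s)
  (Vunif : forall A : set R, measurable A -> distribution P V A = unif01 R A)
  (VS : indep_of_index P V S)
  (psi : d.-tuple R -> 'I_K -> R)
  (mpsi : forall s, measurable_fun XX (psi ^~ s))
  (psi01 : forall x s, XX x -> psi x s \in `[0, 1])
  (Vpsi : {ae P, forall o, V o = psi (X o) (S o)})
  (kappa : 'I_K -> R.-pker R ~> d.-tuple R)
  (kappaP : cond_law P XX X V S kappa)
  (fstar : d.-tuple R -> 'I_K -> R)
  (fstarP : bayes_predictor P XX X S Y fstar)
  (fstar_bnd : exists M : R, 0 < M /\
     forall v s, v \in `[0, 1] ->
       nonatomic (pred_law XX kappa fstar v s) /\
       supported_in (pred_law XX kappa fstar v s) `[- M, M]%classic) :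
  let w := weight P S in
  let f0 := f0star w XX kappa psi fstar in
  [/\ fair_solution w XX kappa fstar f0,
      forall f, fair_solution w XX kappa fstar f ->
        {ae P, forall o, f (X o) (S o) = f0 (X o) (S o)} &
      (risk w XX kappa fstar f0 <= unfairness w XX kappa fstar)%E].
Proof.
move=> w f0; have [M [M0 hM]] := fstar_bnd; have [mfs _ _ _] := fstarP.
have kXX s v : v \in `[0, 1] -> kappa s v (~` XX) = 0%E := kappaP.1 s v.
have na v s : v \in `[0, 1] -> nonatomic (pred_law XX kappa fstar v s).
  by move=> v01; have [] := hM v s v01.
have supp v s : v \in `[0, 1] ->
    supported_in (pred_law XX kappa fstar v s) `[- M, M]%classic.
  by move=> v01; have [] := hM v s v01.
have mf0 : predictor XX f0 by exact: (predictor_f0star _ mXX mfs mpsi M0 psi01 kXX na supp).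
have w1 : \sum_s w s = 1 by exact: sum_weight.
have w_ge0 s : 0 <= w s by exact/ltW/w_gt0.
have mI : measurable (`[0, 1]%classic : set R) by exact: measurable_itv.
have good : {ae unif01 R, forall v, v \in `[0, 1] /\
    forall s, (kappa s v).-negligible [set x | XX x /\ f0 x s <>
      \sum_(s' < K) w s' * quantile (pred_law XX kappa fstar v s')
        (cdf_of (pred_law XX kappa fstar v s) (fstar x s))]}.
  have in01 : {ae unif01 R, forall v, v \in `[0, 1]}.
    exists (~` `[0, 1]%classic); split; first exact: measurableC.
      exact: (unif01_out V01 Vunif).
    by move=> v.
  have kpsi : {ae unif01 R, forall v, forall s : 'I_K,
      (kappa s v).-negligible [set x | XX x /\ psi x s <> v]}.
    apply: ae_forall_count => s.
    exact: (kappa_psi mXX mS w_gt0 Vunif VS mpsi Vpsi kappaP).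
  apply: (ae_mp2 in01 kpsi) => v v01 hv; split => // s.
  (* Where psi x s = v, unfolding [f0star] gives the formula at v. *)
  apply: negligibleS (hv s) => x /= [Xx h]; split => // pv.
  by apply: h; rewrite /f0 /f0star pv.
have fair0 : counterfactually_fair XX kappa f0.
  apply: (ae_mp2 good good) => v [v01 f0E] _ s s' B mB.
  exact: (f0_fair_at w_gt0 w1 M0 mXX mfs mf0 (fun s => kXX s v v01)
    (fun s => na v s v01) (fun s => supp v s v01) f0E).
have optimal g : predictor XX g -> counterfactually_fair XX kappa g ->
    {ae unif01 R, forall v, v \in `[0, 1] ->
      (risk_at w XX kappa fstar f0 v <= risk_at w XX kappa fstar g v)%E}.
  move=> mg gfair; apply: (ae_mp2 good gfair) => v [v01 f0E] gv _.
  exact: (risk_at_le w_gt0 w1 M0 mXX mfs mf0 (fun s => kXX s v v01)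
    (fun s => na v s v01) (fun s => supp v s v01) f0E mg gv).
have mrisk g : predictor XX g ->
    measurable_fun (`[0, 1]%classic : set R) (risk_at w XX kappa fstar g).
  by move=> mg; apply: measurable_funTS; exact: measurable_risk_at.
have risk_le g : predictor XX g -> counterfactually_fair XX kappa g ->
    (risk w XX kappa fstar f0 <= risk w XX kappa fstar g)%E.
  move=> mg gfair; apply: ae_ge0_le_integral => //.
  - by move=> v _; exact: risk_at_ge0.
  - exact: mrisk.
  - by move=> v _; exact: risk_at_ge0.
  - exact: mrisk.
  - exact: optimal.
split => //.
- move=> f [mf ffair fmin].
  have risk_fin : (risk w XX kappa fstar f0 < +oo)%E.
    apply: (@le_lt_trans _ _ (\int[unif01 R]_(v in `[0%R, 1%R]) (M ^+ 2)%:E)%E).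
      apply: ae_ge0_le_integral => //.
      - by move=> v _; exact: risk_at_ge0.
      - exact: mrisk.
      - by move=> v _; rewrite lee_fin sqr_ge0.
      - apply: (ae_mp2 good good) => v [v01 f0E] _ _.
        exact: (risk_at_bounded w_gt0 w1 M0 mXX mfs mf0 (fun s => kXX s v v01)
          (fun s => na v s v01) (fun s => supp v s v01) f0E).
    rewrite integral_cst//= lte_mul_pinfty ?lee_fin ?sqr_ge0//.
    by rewrite ltey_eq fin_num_measure.
  have risk_eq : ae_eq (unif01 R) (`[0, 1]%classic : set R)
      (risk_at w XX kappa fstar f0) (risk_at w XX kappa fstar f).
    apply: le_integral_ae_eq => //; try exact: mrisk;
      try by move=> v _; exact: risk_at_ge0.
    - exact: optimal.
    - exact: fmin.
  have null s : {ae unif01 R, forall v,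
      kappa s v (XX `&` [set x | f x s != f0 x s]) = 0%E}.
    have goodf := ae_mp2 good ffair (fun v a b => conj a b).
    apply: (ae_mp2 goodf risk_eq) => v [[v01 f0E] fv] rv.
    apply/negligibleP; last first.
      have := risk_at_eq w_gt0 w1 M0 mXX mfs mf0 (fun s => kXX s v v01)
        (fun s => na v s v01) (fun s => supp v s v01) f0E mf fv.
      rewrite rv// => /(_ (lexx _) s); apply: negligibleS => x /= [Xx /eqP].
      by [].
    exact: measurable_disagreement.
  have Pnull s : P (S @^-1` [set s] `&` X @^-1` (XX `&` [set x | f x s != f0 x s])) = 0%E.
    apply: (kappa_null_inv mS Vunif kappaP _ (null s)).
    exact: measurable_disagreement.
  have neg s : P.-negligible [set o | S o = s /\ f (X o) s <> f0 (X o) s].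
    apply: negligibleS (_ : P.-negligible
      (S @^-1` [set s] `&` X @^-1` (XX `&` [set x | f x s != f0 x s]))).
      by move=> o [So h]; split => //; split; [exact: X_in|exact/eqP].
    apply/negligibleP; last exact: Pnull.
    apply: measurableI; first exact: mS.
    by apply: measurable_X; exact: measurable_disagreement.
  apply: negligibleS (negligible_bigcup_count neg) => o h.
  by exists (S o).
- have [N [mN N0 hN]] := good.
  (* Removing N first makes the bound hold at every remaining v, so that the unfairness is compared
     pointwise, without an almost-everywhere argument on it. *)
  rewrite /risk (ge0_negligible_integral mN)//; last 2 first.
  - exact: mrisk.
  - by move=> v _; exact: risk_at_ge0.
  apply: ge0_le_integral_outer.
  - by move=> v [].
  - by move=> v _; exact: risk_at_ge0.
  - by move=> v _; exact: unfairness_at_ge0.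
  - move=> v [_ Nv]; have [v01 f0E] := contrapT (fun h => Nv (hN v h)).
    exact: (risk_at_le_unfairness w_gt0 w1 M0 mXX mfs mf0 (fun s => kXX s v v01)
      (fun s => na v s v01) (fun s => supp v s v01) f0E).
Qed.
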